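(* Let $0<p<1$ and $0<\varepsilon<1$, and let $\{(n_m,\lambda,\rho)\}_{m\in\mathbb{N}}$ be a sequence of systematic accumulate-repeat-accumulate (ARA) ensembles with block lengths $n_m\to\infty$, transmitted over a binary erasure channel (BEC) with erasure probability $p$. Assume that this sequence achieves a fraction $1-\varepsilon$ of the channel capacity under message-passing decoding. Let $L_2=L_2(\varepsilon)$ be the fraction of 'punctured bit' nodes of degree $2$ (the two edges related to the accumulator not being counted). In the asymptotic case where the block length tends to infinity, let $l=l(\varepsilon,p,P_{\mathrm b})$ designate the number of iterations required to achieve an average bit erasure probability $P_{\mathrm b}$ of the systematic bits, where $0\le P_{\mathrm b}\le p$. If $1-\sqrt{1-\frac{P_{\mathrm b}}{p}}<p\,L_2(\varepsilon)$, then $$l(\varepsilon,p,P_{\mathrm b})\;\ge\;2p(1-\varepsilon)\left(\sqrt{p\,L_2(\varepsilon)}-\sqrt{1-\sqrt{1-\frac{P_{\mathrm b}}{p}}}\,\right)^2\frac1\varepsilon .$$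
   Context: Systematic ARA ensembles. The $k$ information (systematic) bits are accumulated (differentially encoded), giving 'punctured bits', which are not transmitted; these are repeated by an irregular repetition code and interleaved; the interleaved bits are partitioned into sets whose parities are computed (irregular single parity-check code); these parities are accumulated a second time to give the 'code bits'. A codeword consists of the systematic bits and the code bits. In the Tanner graph, 'parity-check 1' nodes correspond to the first accumulator (joining systematic and punctured bits) and 'parity-check 2' nodes to the second (joining punctured bits and code bits). Degrees of 'punctured bit' and 'parity-check 2' nodes count only edges between these two layers (not the two extra accumulator edges at each node). With $L_i$ (resp. $R_i$) the fraction of punctured bit (resp. parity-check 2) nodes of degree $i$, put $L(x)=\sum_{i\ge1}L_ix^i$, $R(x)=\sum_{i\ge1}R_ix^i$. The edge-perspective distributions are $\lambda(x)=\sum_{i\ge1}\lambda_ix^{i-1}=L'(x)/L'(1)$ and $\rho(x)=\sum_{i\ge1}\rho_ix^{i-1}=R'(x)/R'(1)$. All coefficients are non-negative and $L(1)=R(1)=\lambda(1)=\rho(1)=1$. Let $a_{\mathrm L}=L'(1)$, $a_{\mathrm R}=R'(1)$; the design rate is $R_{\mathrm d}=\frac{a_{\mathrm R}}{a_{\mathrm L}+a_{\mathrm R}}$. Asymptotic analysis (density evolution). In the limit of infinite block length, the erasure probabilities $x_0^{(l)},\dots,x_5^{(l)}$ of the message types at iteration $l=0,1,2,\dots$ (respectively: parity-check 1 to punctured bit; punctured bit to parity-check 2; parity-check 2 to code bit; code bit to parity-check 2; parity-check 2 to punctured bit; punctured bit to parity-check 1) satisfy $$x_0^{(l)}=1-(1-x_5^{(l-1)})(1-p),\quad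 x_1^{(l)}=(x_0^{(l)})^2\lambda(x_4^{(l-1)}),\quad x_2^{(l)}=1-R(1-x_1^{(l)})(1-x_3^{(l-1)}),$$ $$x_3^{(l)}=p\,x_2^{(l)},\quad x_4^{(l)}=1-(1-x_3^{(l)})^2\rho(1-x_1^{(l)}),\quad x_5^{(l)}=x_0^{(l)}L(x_4^{(l)}),$$ with $x_i^{(-1)}=1$ (all messages initially erased), so that $x_0^{(0)}=x_1^{(0)}=1$. The average erasure probability of the systematic bits after iteration $l$ is $P_{\mathrm b}^{(l)}=p\bigl[1-(1-x_5^{(l)})^2\bigr]$. Achieving a fraction of capacity. The BEC has capacity $C=1-p$. The sequence achieves a fraction $1-\varepsilon$ of capacity under message-passing decoding if its (design) rate satisfies $R_{\mathrm d}\ge(1-\varepsilon)C$ and the achievable bit erasure probability vanishes, i.e. all $x_i^{(l)}\to0$ $(0\le i\le5$, apart from $x_0^{(l)}\to p)$ and in particular $P_{\mathrm b}^{(l)}\to0$ as $l\to\infty$. Number of iterations. Since iterations are counted from $0$, $l(\varepsilon,p,P_{\mathrm b})$ is the smallest integer $l\ge1$ with $P_{\mathrm b}^{(l-1)}\le P_{\mathrm b}$ (it is $\infty$ if there is none). *)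

(* Defs.v *)
From Stdlib Require Import Reals Classical.
From Coquelicot Require Import Coquelicot.
Open Scope R_scope.

(* Node-perspective degree distribution: [d i] is the fraction of nodes of
   degree [i].  Infinite support is allowed; the mean degree must be finite,
   since the edge-perspective distribution divides by it. *)
Record degree_distribution (d : nat -> R) : Prop := {
  dd_degree_pos : d 0%nat = 0;
  dd_nonneg : forall i, 0 <= d i;
  dd_sum : is_pseries d 1 1;
  dd_mean : ex_pseries (PS_derive d) 1
}.

(* [d'(1)], the derivative being taken term by term, as 1 may lie on the
   boundary of the disc of convergence. *)
Definition mean_degree (d : nat -> R) : R := PSeries (PS_derive d) 1.

Definition edge_series (d : nat -> R) (x : R) : R :=
  PSeries (PS_derive d) x / mean_degree d.

(* A sequence of ensembles [(n m, lambda, rho)].  [L] and [Rc] are the node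
   distributions of the punctured bits and of the parity-checks 2; [lambda] and
   [rho] are [edge_series L] and [edge_series Rc]. *)
Record ara_sequence (n : nat -> nat) (L Rc : nat -> R) : Prop := {
  ara_length : is_lim_seq (fun m => INR (n m)) p_infty;
  ara_punctured : degree_distribution L;
  ara_check2 : degree_distribution Rc
}.

Definition design_rate (L Rc : nat -> R) : R :=
  mean_degree Rc / (mean_degree L + mean_degree Rc).

(* Erasure probabilities of the messages:
   x0: parity-check 1 to punctured bit;   x1: punctured bit to parity-check 2;
   x2: parity-check 2 to code bit;        x3: code bit to parity-check 2;
   x4: parity-check 2 to punctured bit;   x5: punctured bit to parity-check 1. *)
Record messages := Messages { x0 : R; x1 : R; x2 : R; x3 : R; x4 : R; x5 : R }.

Definition all_erased : messages := Messages 1 1 1 1 1 1.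

Definition de_step (L Rc : nat -> R) (p : R) (prev : messages) : messages :=
  let y0 := 1 - (1 - x5 prev) * (1 - p) in
  let y1 := y0 ^ 2 * edge_series L (x4 prev) in
  let y2 := 1 - PSeries Rc (1 - y1) * (1 - x3 prev) in
  let y3 := p * y2 in
  let y4 := 1 - (1 - y3) ^ 2 * edge_series Rc (1 - y1) in
  let y5 := y0 * PSeries L y4 in
  Messages y0 y1 y2 y3 y4 y5.

(* Iterations are counted from 0 and [all_erased] is the state at time -1, so
   the state after iteration [l] results from [l + 1] steps. *)
Definition density_evolution (L Rc : nat -> R) (p : R) (l : nat) : messages :=
  Nat.iter (S l) (de_step L Rc p) all_erased.

Definition systematic_erasure (L Rc : nat -> R) (p : R) (l : nat) : R :=
  p * (1 - (1 - x5 (density_evolution L Rc p l)) ^ 2).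

Record achieves_fraction (L Rc : nat -> R) (p eps : R) : Prop := {
  af_rate : design_rate L Rc >= (1 - eps) * (1 - p);
  af_x0 : is_lim_seq (fun l => x0 (density_evolution L Rc p l)) p;
  af_x1 : is_lim_seq (fun l => x1 (density_evolution L Rc p l)) 0;
  af_x2 : is_lim_seq (fun l => x2 (density_evolution L Rc p l)) 0;
  af_x3 : is_lim_seq (fun l => x3 (density_evolution L Rc p l)) 0;
  af_x4 : is_lim_seq (fun l => x4 (density_evolution L Rc p l)) 0;
  af_x5 : is_lim_seq (fun l => x5 (density_evolution L Rc p l)) 0;
  af_Pb : is_lim_seq (systematic_erasure L Rc p) 0
}.

Definition enough_iterations (L Rc : nat -> R) (p Pb : R) (l : nat) : Prop :=
  (1 <= l)%nat /\ systematic_erasure L Rc p (l - 1) <= Pb.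

(* The least [l] with [enough_iterations], or [p_infty] if there is none. *)
Definition num_iterations (L Rc : nat -> R) (p Pb : R) : Rbar :=
  match LPO_min (enough_iterations L Rc p Pb) (fun l => classic _) with
  | inleft (exist l _) => Finite (INR l)
  | inright _ => p_infty
  end.

(* Main.v *)
Require Import Defs.
From Stdlib Require Import Reals Lra Lia Psatz.
From Coquelicot Require Import Coquelicot.
Open Scope R_scope.

(* Replacing the two accumulators by their fixed points only speeds up density
   evolution and turns it into the recursion [v := 1 - g (1 - f v)] of an LDPC
   ensemble, where [f] and [g] are [p^2 lambda / (1 - (1-p) L)^2] and
   [(1-p)^2 rho / (1 - p R)^2]. In the unit square the iterates form a staircase
   between the graphs of [f] and of [g], and the area between the graphs is
   [(1-p)/aR - p/aL], at most [eps / ((1 - eps) aL)] by the rate hypothesis. The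
   slope of [f] is at least [s = p^2 lambda_2]; since decoding succeeds and [g] is
   convex, the slope of [g] is at most [1/s]. Hence a step of height [h] accounts
   for two triangles of area [s h^2 / 2], and Cauchy-Schwarz gives
   [l * area >= s (1 - v_l)^2], while [x5 >= p L_2 v_l^2].
   One of the two triangles of the first step sticks out of the square. This is
   compensated by the excess of the slope of [f] near 1, by the area left after
   step [l] (steps decay at most geometrically, because [g] has a power series
   with non-negative coefficients), and by the variance of the step heights. *)

(** * Series with non-negative terms *)

Lemma is_series_le (u v : nat -> R) (A B : R) :
  is_series u A -> is_series v B -> (forall n, u n <= v n) -> A <= B.
Proof.
intros Hu Hv Huv.
apply (is_lim_seq_le (sum_n u) (sum_n v) A B); [|exact Hu | exact Hv].
intros n. now apply sum_n_m_le.
Qed.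

(** Comparison with the series whose only term is [u k], of any sign. It serves to keep the degree-2
    term of a series and to drop the others. *)
Lemma is_series_ge_term (u : nat -> R) (A : R) (k : nat) :
  is_series u A -> (forall n, n <> k -> 0 <= u n) -> u k <= A.
Proof.
intros Hu Hpos.
assert (Hk : is_series (fun n => if Nat.eqb n k then u n else 0) (u k)).
{ assert (Hc : forall j, sum_n (fun n => if Nat.eqb n k then u n else 0) (k + j) = u k).
  { assert (H0 : forall j, (j < k)%nat -> sum_n (fun n => if Nat.eqb n k then u n else 0) j = 0).
    { induction j as [|j IH]; intros Hj.
      - rewrite sum_O. destruct (Nat.eqb_spec 0 k); [lia | reflexivity].
      - rewrite sum_Sn, IH by lia. destruct (Nat.eqb_spec (S j) k); [lia|]. apply Rplus_0_l. }
    induction j as [|j IH].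
    - rewrite Nat.add_0_r. destruct k as [|k'].
      + now rewrite sum_O.
      + rewrite sum_Sn, H0 by lia. rewrite Nat.eqb_refl. apply Rplus_0_l.
    - rewrite Nat.add_succ_r, sum_Sn, IH.
      destruct (Nat.eqb_spec (S (k + j)) k); [lia|]. apply Rplus_0_r. }
  change (is_lim_seq (sum_n (fun n => if Nat.eqb n k then u n else 0)) (u k)).
  apply (is_lim_seq_incr_n _ k).
  apply is_lim_seq_ext with (fun _ => u k); [|apply is_lim_seq_const].
  intros j. now rewrite Nat.add_comm, Hc. }
apply (is_series_le _ _ _ _ Hk Hu). intros n.
destruct (Nat.eqb_spec n k) as [->|Hn]; [apply Rle_refl | now apply Hpos].
Qed.

Lemma is_series_sub (u v : nat -> R) (A B : R) :
  is_series u A -> is_series v B -> is_series (fun n => u n - v n) (A - B).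
Proof. exact (is_series_minus u v A B). Qed.

Lemma pow_unit x n : 0 <= x <= 1 -> 0 <= x ^ n <= 1.
Proof.
intros H. split; [now apply pow_le|]. rewrite <- (pow1 n). now apply pow_incr.
Qed.

(** Convergence is asked at 1 itself, so that the sum is available on the closed unit interval even
    if 1 is on the boundary of the disc of convergence. *)
Definition nonneg_series (a : nat -> R) : Prop :=
  (forall n, 0 <= a n) /\ ex_pseries a 1.

Lemma nonneg_series_correct a x : nonneg_series a -> 0 <= x <= 1 ->
  is_series (fun n => a n * x ^ n) (PSeries a x).
Proof.
intros [Ha H1] Hx. apply is_pseries_R, PSeries_correct.
apply (ex_series_le (fun n => scal (pow_n x n) (a n)) (fun n => scal (pow_n 1 n) (a n)));
  [|exact H1].
intros n. change (Rabs (pow_n x n * a n) <= pow_n 1 n * a n).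
rewrite !pow_n_pow, pow1. destruct (pow_unit x n Hx). specialize (Ha n).
rewrite Rabs_pos_eq by (apply Rmult_le_pos; lra). apply Rmult_le_compat_r; lra.
Qed.

Lemma nonneg_series_decr_1 a : nonneg_series a -> nonneg_series (PS_decr_1 a).
Proof.
intros [Ha H1]; split; [intros n; apply Ha|].
apply ex_pseries_decr_1; [|exact H1]. right. exists 1. apply Rmult_1_l.
Qed.

Lemma PSeries_nonneg a x : nonneg_series a -> 0 <= x <= 1 -> 0 <= PSeries a x.
Proof.
intros Ha Hx. apply (is_series_le (fun _ => 0) (fun n => a n * x ^ n)).
- change (is_lim_seq (sum_n (fun _ => 0)) 0).
  apply is_lim_seq_ext with (fun _ => 0); [|apply is_lim_seq_const].
  intros n. rewrite sum_n_const. ring.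
- now apply nonneg_series_correct.
- intros n. apply Rmult_le_pos; [apply Ha | now apply pow_unit].
Qed.

Lemma PSeries_increasing a x y : nonneg_series a -> 0 <= x <= y -> y <= 1 ->
  PSeries a x <= PSeries a y.
Proof.
intros Ha Hx Hy.
apply (is_series_le (fun n => a n * x ^ n) (fun n => a n * y ^ n)).
- apply nonneg_series_correct; [exact Ha | lra].
- apply nonneg_series_correct; [exact Ha | lra].
- intros n. apply Rmult_le_compat_l; [apply Ha | now apply pow_incr].
Qed.

(** * Expansions to second order at 0 *)

(* The functions [a0 + a1 x + x^2 k x] with [k] non-negative and non-decreasing
   stand in for the power series with non-negative coefficients; unlike the
   latter, they are readily seen to be closed under products and under
   [R |-> 1 / (1 - p R)]. *)
Definition quadratic_expansion (g : R -> R) (a0 a1 : R) : Prop :=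
  0 <= a0 /\ 0 <= a1 /\
  exists k : R -> R,
    (forall x, 0 <= x <= 1 -> 0 <= k x) /\
    (forall x y, 0 <= x <= y -> y <= 1 -> k x <= k y) /\
    (forall x, 0 <= x <= 1 -> g x = a0 + a1 * x + x ^ 2 * k x).

Lemma quadratic_expansion_PSeries a : nonneg_series a ->
  quadratic_expansion (PSeries a) (a 0%nat) (a 1%nat).
Proof.
intros Ha.
assert (Ha1 := nonneg_series_decr_1 _ Ha).
assert (Ha2 := nonneg_series_decr_1 _ Ha1).
split; [apply Ha | split; [apply Ha|]].
exists (PSeries (PS_decr_1 (PS_decr_1 a))).
split; [|split].
- intros x Hx. now apply PSeries_nonneg.
- intros x y Hx Hy. now apply PSeries_increasing.
- intros x Hx.
  rewrite PSeries_decr_1 by (eexists; apply is_pseries_R, nonneg_series_correct; assumption).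
  rewrite (PSeries_decr_1 (PS_decr_1 a))
    by (eexists; apply is_pseries_R, nonneg_series_correct; assumption).
  change (PS_decr_1 a 0%nat) with (a 1%nat). ring.
Qed.

Lemma quadratic_expansion_slope g a0 a1 x y : quadratic_expansion g a0 a1 ->
  0 <= x <= y -> y <= 1 -> a1 * (y - x) <= g y - g x.
Proof.
intros (H0 & H1 & k & Hk & Hkk & Hg) Hx Hy.
rewrite (Hg x), (Hg y) by lra.
assert (x ^ 2 * k x <= y ^ 2 * k y); [|lra].
apply Rmult_le_compat; [apply pow2_ge_0 | apply Hk; lra | now apply pow_incr | now apply Hkk].
Qed.

Lemma quadratic_expansion_mult g h a0 a1 b0 b1 :
  quadratic_expansion g a0 a1 -> quadratic_expansion h b0 b1 ->
  quadratic_expansion (fun x => g x * h x) (a0 * b0) (a0 * b1 + a1 * b0).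
Proof.
intros (Ha0 & Ha1 & k & Hk & Hkk & Hg) (Hb0 & Hb1 & l & Hl & Hll & Hh).
split; [nra | split; [nra|]].
(* All terms of order at least 2 in the product, grouped so that each is a product of non-negative
   non-decreasing functions. *)
exists (fun x => a0 * l x + a1 * (b1 + x * l x) + k x * (b0 + b1 * x + x ^ 2 * l x)).
split; [|split].
- intros x Hx. specialize (Hk x Hx). specialize (Hl x Hx).
  assert (0 <= x * l x) by (apply Rmult_le_pos; lra).
  assert (0 <= x ^ 2 * l x) by (apply Rmult_le_pos; [apply pow2_ge_0 | lra]).
  assert (0 <= b1 * x) by (apply Rmult_le_pos; lra).
  repeat apply Rplus_le_le_0_compat; repeat apply Rmult_le_pos;
    repeat apply Rplus_le_le_0_compat; lra.
- intros x y Hx Hy.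
  assert (Hlx : 0 <= l x <= l y) by (split; [apply Hl; lra | now apply Hll]).
  assert (Hkx : 0 <= k x <= k y) by (split; [apply Hk; lra | now apply Hkk]).
  assert (0 <= x * l x <= y * l y).
  { split; [apply Rmult_le_pos; lra | apply Rmult_le_compat; lra]. }
  assert (0 <= x ^ 2 * l x <= y ^ 2 * l y).
  { split; [apply Rmult_le_pos; [apply pow2_ge_0 | lra]|].
    apply Rmult_le_compat; [apply pow2_ge_0 | lra | now apply pow_incr | lra]. }
  assert (0 <= b1 * x <= b1 * y).
  { split; [apply Rmult_le_pos; lra | apply Rmult_le_compat_l; lra]. }
  repeat apply Rplus_le_compat.
  + apply Rmult_le_compat_l; lra.
  + apply Rmult_le_compat_l; lra.
  + apply Rmult_le_compat; lra.
- intros x Hx. rewrite Hg, Hh by assumption. ring.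
Qed.

(* The expansion of [g] is compared with the extremal [k], which is constant. *)
Lemma quadratic_expansion_linear_coef g a0 a1 c : quadratic_expansion g a0 a1 ->
  g 1 = 1 -> (forall x, 0 <= x <= 1 -> 1 - g x <= c * (1 - x)) ->
  2 * (1 - a0) - c <= a1.
Proof.
intros (Ha0 & Ha1 & k & Hk & Hkk & Hg) Hg1 Hc.
assert (Hk1 : g 1 = a0 + a1 + k 1) by (rewrite (Hg 1) by lra; ring).
rewrite Hg1 in Hk1.
assert (Hk1' : 0 <= k 1) by (apply Hk; lra).
apply le_epsilon. intros e He.
(* A secant over [[1 - d, 1]] replaces the slope at 1: it gives [a1 + (2 - d) * k 1 <= c], and since
   [k 1 <= 1] the error is at most [d <= e]. *)
set (d := Rmin e 1).
assert (Hd : 0 < d <= 1) by (unfold d, Rmin; destruct Rle_dec; lra).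
assert (Hde : d <= e) by apply Rmin_l.
specialize (Hc (1 - d) ltac:(lra)). rewrite Hg in Hc by lra.
assert (Hkd : (1 - d) ^ 2 * k (1 - d) <= (1 - d) ^ 2 * k 1).
{ apply Rmult_le_compat_l; [apply pow2_ge_0 | apply Hkk; lra]. }
assert (H : d * (a1 + (2 - d) * k 1) <= d * c) by nra.
apply Rmult_le_reg_l in H; [|lra].
assert (d * k 1 <= d * 1) by (apply Rmult_le_compat_l; lra). nra.
Qed.

(** * Convexity towards 1, and the area below a slope bound *)

(** Convexity for chords ending at 1 only: enough to bound slopes, and easily transferred to
    products and fixed points. *)
Definition chord_to_1 (g : R -> R) : Prop :=
  forall x t, 0 <= x <= 1 -> 0 <= t <= 1 ->
    g ((1 - t) * x + t) <= (1 - t) * g x + t * g 1.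

Lemma chord_point x t : 0 <= x <= 1 -> 0 <= t <= 1 -> x <= (1 - t) * x + t <= 1.
Proof. intros; nra. Qed.

(** The product of the chords lies below the chord of the product by [t * (1 - t) * ((g 1 - g x) *
    (h 1 - h x))], non-negative because both functions are largest at 1. *)
Lemma chord_to_1_mult g h :
  (forall x, 0 <= x <= 1 -> 0 <= g x <= g 1) -> (forall x, 0 <= x <= 1 -> 0 <= h x <= h 1) ->
  chord_to_1 g -> chord_to_1 h -> chord_to_1 (fun x => g x * h x).
Proof.
intros Hg Hh Cg Ch x t Hx Ht.
assert (Hy := chord_point x t Hx Ht).
specialize (Cg x t Hx Ht). specialize (Ch x t Hx Ht).
assert (Hgy : 0 <= g ((1 - t) * x + t)) by (apply Hg; lra).
assert (Hhy : 0 <= h ((1 - t) * x + t)) by (apply Hh; lra).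
apply Rle_trans with (((1 - t) * g x + t * g 1) * ((1 - t) * h x + t * h 1)).
- now apply Rmult_le_compat.
- assert (0 <= t * (1 - t) * ((g 1 - g x) * (h 1 - h x))); [|nra].
  destruct (Hg x Hx), (Hh x Hx). repeat apply Rmult_le_pos; lra.
Qed.

Lemma chord_to_1_pow n : chord_to_1 (fun x => x ^ n).
Proof.
induction n as [|n IH].
- intros x t Hx Ht; simpl. lra.
- apply (chord_to_1_mult (fun x => x) (fun x => x ^ n)).
  + intros x Hx; lra.
  + intros x Hx. rewrite pow1. now apply pow_unit.
  + intros x t Hx Ht; lra.
  + exact IH.
Qed.

Lemma chord_to_1_PSeries a : nonneg_series a -> chord_to_1 (PSeries a).
Proof.
intros Ha x t Hx Ht.
assert (Hy := chord_point x t Hx Ht).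
assert (S1 := is_series_plus _ _ _ _
  (is_series_scal_l (1 - t) _ _ (nonneg_series_correct a x Ha Hx))
  (is_series_scal_l t _ _ (nonneg_series_correct a 1 Ha ltac:(lra)))).
apply (is_series_le _ _ _ _ (nonneg_series_correct a _ Ha (conj (Rle_trans _ _ _ (proj1 Hx) (proj1 Hy)) (proj2 Hy))) S1).
intros n.
change (a n * ((1 - t) * x + t) ^ n <= (1 - t) * (a n * x ^ n) + t * (a n * 1 ^ n)).
assert (H := chord_to_1_pow n x t Hx Ht). simpl in H.
apply Rle_trans with (a n * ((1 - t) * x ^ n + t * 1 ^ n)); [|right; ring].
apply Rmult_le_compat_l; [apply Ha | exact H].
Qed.

(** By convexity the chord from [x] to [y] is no steeper than the chord from [x] to 1. *)
Lemma chord_to_1_slope g s x y : chord_to_1 g -> g 1 = 1 -> 0 < s ->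
  (forall x, 0 <= x <= 1 -> s * (1 - g x) <= 1 - x) ->
  0 <= x <= y -> y <= 1 -> s * (g y - g x) <= y - x.
Proof.
intros Cg Hg1 Hs Hline Hx Hy.
destruct (Req_dec x 1) as [->|Hx1]; [replace y with 1 by lra; lra|].
set (t := (y - x) / (1 - x)).
assert (Htx : t * (1 - x) = y - x) by (unfold t; field; lra).
assert (Ht : 0 <= t <= 1).
{ split; [apply Rdiv_le_0_compat; lra|].
  apply Rmult_le_reg_r with (1 - x); lra. }
specialize (Cg x t ltac:(lra) Ht).
replace ((1 - t) * x + t) with y in Cg by lra.
specialize (Hline x ltac:(lra)). rewrite Hg1 in Cg.
apply Rle_trans with (t * (s * (1 - g x))).
- replace (t * (s * (1 - g x))) with (s * (t * (1 - g x))) by ring.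
  apply Rmult_le_compat_l; lra.
- rewrite <- Htx. apply Rmult_le_compat_l; lra.
Qed.

(* The region between the graph of [g] and the level [g x] contains a right
   triangle with legs [g y - g x] and [s (g y - g x)]. *)
Lemma slope_bound_area (G g : R -> R) (s x y : R) :
  0 < s -> x <= y ->
  (forall z, x <= z <= y -> is_derive G z (g z)) ->
  (forall z z', x <= z <= z' -> z' <= y -> g z <= g z') ->
  (forall z z', x <= z <= z' -> z' <= y -> s * (g z' - g z) <= z' - z) ->
  s * (g y - g x) ^ 2 / 2 <= G y - G x - (y - x) * g x.
Proof.
intros Hs Hxy HG Hmono Hslope.
assert (Hincr : forall (P dP : R -> R) u v, u <= v ->
  (forall z, u <= z <= v -> is_derive P z (dP z) /\ 0 <= dP z) -> P u <= P v).
{ intros P dP u v Huv H.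
  destruct (MVT_gen P u v dP) as [c [Hc Heq]].
  - intros z Hz. rewrite Rmin_left, Rmax_right in Hz by lra. apply H; lra.
  - intros z Hz. rewrite Rmin_left, Rmax_right in Hz by lra.
    apply derivable_continuous_pt. exists (dP z). apply is_derive_Reals, H; lra.
  - rewrite Rmin_left, Rmax_right in Hc by lra.
    assert (0 <= dP c * (v - u)) by (apply Rmult_le_pos; [apply H; lra | lra]). lra. }
set (h := g y - g x).
assert (Hh : 0 <= h) by (unfold h; generalize (Hmono x y ltac:(lra) ltac:(lra)); lra).
(* Where the line of slope [1 / s] through [(y, g y)] meets the level [g x]: [g] is bounded below by
   this level left of [z] and by the line right of it. *)
set (z := y - s * h).
assert (Hz : x <= z <= y).
{ unfold z, h. split; [generalize (Hslope x y ltac:(lra) ltac:(lra)); lra|].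
  assert (0 <= s * (g y - g x)) by (apply Rmult_le_pos; [lra | exact Hh]). lra. }
assert (H1 : G x - g x * x <= G z - g x * z).
{ apply (Hincr (fun w => G w - g x * w) (fun w => g w - g x)); [lra|]. intros w Hw. split.
  - apply (is_derive_minus G (fun w => g x * w)); [apply HG; lra|].
    auto_derive; [exact I | ring].
  - generalize (Hmono x w ltac:(lra) ltac:(lra)). lra. }
(* The function subtracted from [G] is an antiderivative of that line. *)
assert (H2 : G z - (g y * z - (y - z) * (y - z) / (2 * s) * -1) <= G y - (g y * y - (y - y) * (y - y) / (2 * s) * -1)).
{ apply (Hincr (fun w => G w - (g y * w - (y - w) * (y - w) / (2 * s) * -1))
    (fun w => g w - (g y - (y - w) / s))); [lra|]. intros w Hw. split.
  - apply (is_derive_minus G (fun w => g y * w - (y - w) * (y - w) / (2 * s) * -1)); [apply HG; lra|].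
    auto_derive; [exact I|]. field. lra.
  - generalize (Hslope w y ltac:(lra) ltac:(lra)). intros H.
    assert (g y - g w <= (y - w) / s); [|lra].
    apply Rmult_le_reg_l with s; [exact Hs|]. replace (s * ((y - w) / s)) with (y - w) by (field; lra).
    exact H. }
replace ((y - y) * (y - y) / (2 * s) * -1) with 0 in H2 by (field; lra).
replace ((y - z) * (y - z) / (2 * s) * -1) with (- (s * h ^ 2 / 2)) in H2 by (unfold z; field; lra).
assert (g y * (y - z) = (g x + h) * (s * h)) by (unfold z, h; ring).
assert (g x * (y - z) = g x * (s * h)) by (unfold z; ring).
nra.
Qed.

(** * Degree distributions *)

Section DegreeDistribution.

Variable d : nat -> R.
Hypothesis Hd : degree_distribution d.

Lemma degree_nonneg_series : nonneg_series d.
Proof. split; [apply (dd_nonneg _ Hd)|]. eexists. apply (dd_sum _ Hd). Qed.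

Lemma degree_derive_nonneg_series : nonneg_series (PS_derive d).
Proof.
split; [|apply (dd_mean _ Hd)]. intros n. unfold PS_derive.
apply Rmult_le_pos; [apply pos_INR | apply (dd_nonneg _ Hd)].
Qed.

Lemma degree_series_1 : PSeries d 1 = 1.
Proof. apply is_pseries_unique, (dd_sum _ Hd). Qed.

Lemma degree_series_0 : PSeries d 0 = 0.
Proof. rewrite PSeries_0. apply (dd_degree_pos _ Hd). Qed.

Lemma degree_series_unit x : 0 <= x <= 1 -> 0 <= PSeries d x <= 1.
Proof.
intros Hx. split; [apply PSeries_nonneg; [apply degree_nonneg_series | exact Hx]|].
rewrite <- degree_series_1. apply PSeries_increasing; [apply degree_nonneg_series | lra | lra].
Qed.

Lemma degree_series_increasing x y : 0 <= x <= y -> y <= 1 -> PSeries d x <= PSeries d y.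
Proof. intros. apply PSeries_increasing; [apply degree_nonneg_series | lra | lra]. Qed.

(** Indexed by the degree, so that the terms line up with those of [PSeries d] and both series can
    be combined term by term, also at 1. *)
Lemma degree_derive_correct x : 0 <= x <= 1 ->
  is_series (fun n => INR n * d n * x ^ pred n) (PSeries (PS_derive d) x).
Proof.
intros Hx. apply is_series_decr_1.
match goal with |- is_series _ ?l => replace l with (PSeries (PS_derive d) x) end.
2: { change (PSeries (PS_derive d) x = PSeries (PS_derive d) x + - (INR 0 * d 0%nat * 1)). simpl. ring. }
exact (nonneg_series_correct _ _ degree_derive_nonneg_series Hx).
Qed.

Lemma pow_chord_le a b n : 0 <= a <= b -> b ^ n - a ^ n <= INR n * b ^ pred n * (b - a).
Proof.
intros Hab. induction n as [|n IH]; [simpl; lra|].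
assert (Hn : b ^ n - a ^ n <= INR n * b ^ pred n * (b - a)) by exact IH.
assert (Hb : 0 <= b ^ n - a ^ n) by (generalize (pow_incr _ _ n Hab); lra).
replace (b ^ S n - a ^ S n) with (b * (b ^ n - a ^ n) + a ^ n * (b - a)) by (simpl; ring).
assert (b * (b ^ n - a ^ n) <= INR n * b ^ n * (b - a)).
{ destruct n as [|n]; [simpl; lra|].
  apply Rle_trans with (b * (INR (S n) * b ^ pred (S n) * (b - a)));
    [apply Rmult_le_compat_l; lra | right; simpl pred; simpl (b ^ S n); ring]. }
rewrite S_INR. simpl pred.
assert (a ^ n * (b - a) <= b ^ n * (b - a)) by (apply Rmult_le_compat_r; lra). nra.
Qed.

(** Each power lies above its tangent at [b], so all terms are non-negative; the one of degree 2 is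
    exactly the left-hand side. *)
Lemma degree_tangent_gap a b : 0 <= a <= b -> b <= 1 ->
  d 2%nat * (b - a) ^ 2 <= PSeries (PS_derive d) b * (b - a) - (PSeries d b - PSeries d a).
Proof.
intros Ha Hb.
assert (S1 := is_series_sub _ _ _ _
  (is_series_scal_r (b - a) _ _ (degree_derive_correct b ltac:(lra)))
  (is_series_sub _ _ _ _ (nonneg_series_correct d b degree_nonneg_series ltac:(lra))
     (nonneg_series_correct d a degree_nonneg_series ltac:(lra)))).
apply (is_series_ge_term _ _ 2) in S1.
- simpl in S1. lra.
- intros n _. generalize (pow_chord_le a b n Ha) (dd_nonneg _ Hd n). intros H Hn.
  replace (INR n * d n * b ^ pred n * (b - a) - (d n * b ^ n - d n * a ^ n))
    with (d n * (INR n * b ^ pred n * (b - a) - (b ^ n - a ^ n))) by ring.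
  apply Rmult_le_pos; lra.
Qed.

Lemma mean_degree_ge_1 : 1 <= mean_degree d.
Proof.
generalize (degree_tangent_gap 0 1 ltac:(lra) ltac:(lra)).
rewrite degree_series_0, degree_series_1. unfold mean_degree.
generalize (dd_nonneg _ Hd 2%nat). lra.
Qed.

Lemma degree_derive_slope x y : 0 <= x <= y -> y <= 1 ->
  2 * d 2%nat * (y - x) <= PSeries (PS_derive d) y - PSeries (PS_derive d) x.
Proof.
intros Hx Hy.
generalize (quadratic_expansion_slope _ _ _ x y
  (quadratic_expansion_PSeries _ degree_derive_nonneg_series) Hx Hy).
unfold PS_derive at 1. simpl INR. lra.
Qed.

Lemma edge_series_1 : edge_series d 1 = 1.
Proof.
unfold edge_series. apply Rinv_r. generalize mean_degree_ge_1. lra.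
Qed.

Lemma edge_series_increasing x y : 0 <= x <= y -> y <= 1 -> edge_series d x <= edge_series d y.
Proof.
intros. unfold edge_series, Rdiv. apply Rmult_le_compat_r.
- apply Rlt_le, Rinv_0_lt_compat. generalize mean_degree_ge_1. lra.
- apply PSeries_increasing; [apply degree_derive_nonneg_series | lra | lra].
Qed.

Lemma edge_series_unit x : 0 <= x <= 1 -> 0 <= edge_series d x <= 1.
Proof.
intros Hx. split.
- apply Rdiv_le_0_compat; [|generalize mean_degree_ge_1; lra].
  apply PSeries_nonneg; [apply degree_derive_nonneg_series | exact Hx].
- rewrite <- edge_series_1. apply edge_series_increasing; lra.
Qed.

Lemma edge_series_slope x y : 0 <= x <= y -> y <= 1 ->
  2 * d 2%nat / mean_degree d * (y - x) <= edge_series d y - edge_series d x.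
Proof.
intros Hx Hy. unfold edge_series.
assert (Hm := mean_degree_ge_1).
replace (2 * d 2%nat / mean_degree d * (y - x))
  with (2 * d 2%nat * (y - x) / mean_degree d) by (field; lra).
replace (PSeries (PS_derive d) y / mean_degree d - PSeries (PS_derive d) x / mean_degree d)
  with ((PSeries (PS_derive d) y - PSeries (PS_derive d) x) / mean_degree d) by (field; lra).
apply Rmult_le_compat_r; [|now apply degree_derive_slope].
apply Rlt_le, Rinv_0_lt_compat. lra.
Qed.

Lemma degree_series_le_id x : 0 <= x <= 1 -> PSeries d x <= x.
Proof.
intros Hx.
rewrite <- (Rmult_1_l x) at 2. rewrite <- degree_series_1.
apply (is_series_le _ _ _ _ (nonneg_series_correct d x degree_nonneg_series Hx)
  (is_series_scal_r x _ _ (nonneg_series_correct d 1 degree_nonneg_series ltac:(lra)))).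
intros [|n]; [rewrite (dd_degree_pos _ Hd); lra|].
rewrite pow1. simpl. generalize (dd_nonneg _ Hd (S n)) (pow_unit x n Hx). intros.
assert (0 <= d (S n) * x) by (apply Rmult_le_pos; lra).
replace (d (S n) * (x * x ^ n)) with (d (S n) * x * x ^ n) by ring. nra.
Qed.

Lemma degree_cv_radius : Rbar_le 1 (CV_radius d).
Proof.
apply (proj1 (CV_radius_bounded d)). exists 1. intros n.
rewrite pow1, Rmult_1_r, Rabs_pos_eq by apply (dd_nonneg _ Hd).
assert (S1 := nonneg_series_correct d 1 degree_nonneg_series ltac:(lra)).
rewrite degree_series_1 in S1.
apply (is_series_ge_term _ _ n) in S1.
- cbv beta in S1. now rewrite pow1, Rmult_1_r in S1.
- intros k _. rewrite pow1, Rmult_1_r. apply (dd_nonneg _ Hd).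
Qed.

Section NoDegreeOne.

Hypothesis Hd1 : d 1%nat = 0.

Lemma degree_series_le_square x : 0 <= x <= 1 -> PSeries d x <= x ^ 2.
Proof.
intros Hx.
rewrite <- (Rmult_1_l (x ^ 2)). rewrite <- degree_series_1.
apply (is_series_le _ _ _ _ (nonneg_series_correct d x degree_nonneg_series Hx)
  (is_series_scal_r (x ^ 2) _ _ (nonneg_series_correct d 1 degree_nonneg_series ltac:(lra)))).
intros [|[|n]]; [rewrite (dd_degree_pos _ Hd); lra | rewrite Hd1; lra|].
rewrite pow1. generalize (dd_nonneg _ Hd (S (S n))) (pow_unit x n Hx) (pow2_ge_0 x). intros.
assert (0 <= d (S (S n)) * x ^ 2) by (apply Rmult_le_pos; lra).
replace (d (S (S n)) * x ^ S (S n)) with (d (S (S n)) * x ^ 2 * x ^ n) by (simpl; ring). nra.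
Qed.

Lemma edge_series_le_id x : 0 <= x <= 1 -> edge_series d x <= x.
Proof.
intros Hx. assert (Hm := mean_degree_ge_1).
unfold edge_series. apply Rmult_le_reg_r with (mean_degree d); [lra|].
unfold Rdiv. rewrite Rmult_assoc, Rinv_l, Rmult_1_r by lra.
rewrite Rmult_comm. unfold mean_degree.
apply (is_series_le _ _ _ _ (nonneg_series_correct _ x degree_derive_nonneg_series Hx)
  (is_series_scal_r x _ _ (nonneg_series_correct _ 1 degree_derive_nonneg_series ltac:(lra)))).
intros [|n]; [unfold PS_derive; rewrite Hd1; lra|].
generalize (proj1 degree_derive_nonneg_series (S n)). set (c := PS_derive d (S n)). intros Hc.
rewrite pow1. simpl. destruct (pow_unit x n Hx).
assert (0 <= c * x) by (apply Rmult_le_pos; lra).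
replace (c * (x * x ^ n)) with (c * x * x ^ n) by ring. nra.
Qed.

(** [(1 - (1 - h) ^ n) / n] is the integral of [w ^ (n - 1)] over [[1 - h, 1]], hence non-increasing
    in [n]; the factor on the right is its value at degree 3. *)
Lemma one_minus_pow_le h n : 0 <= h <= 1 ->
  1 - (1 - h) ^ (3 + n) <= INR (3 + n) * (h - h ^ 2 + h ^ 3 / 3).
Proof.
intros Hh. induction n as [|n IH]; [simpl; right; field|].
rewrite Nat.add_succ_r, S_INR.
replace (1 - (1 - h) ^ S (3 + n)) with (1 - (1 - h) ^ (3 + n) + (1 - h) ^ (3 + n) * h)
  by (simpl; ring).
assert ((1 - h) ^ (3 + n) <= (1 - h) ^ 2).
{ rewrite pow_add. replace ((1 - h) ^ 3) with ((1 - h) ^ 2 * (1 - h)) by ring.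
  destruct (pow_unit (1 - h) n ltac:(lra)). assert (0 <= (1 - h) ^ 2) by apply pow2_ge_0.
  assert ((1 - h) * (1 - h) ^ n <= 1) by nra. nra. }
assert ((1 - h) ^ (3 + n) * h <= (1 - h) ^ 2 * h) by (apply Rmult_le_compat_r; lra).
assert (0 <= h ^ 2 * (1 - h)) by (apply Rmult_le_pos; [apply pow2_ge_0 | lra]).
assert (0 <= h ^ 2) by apply pow2_ge_0.
nra.
Qed.

(** The left-hand side is the integral of [edge_series d] over [[1 - h, 1]]. Degrees above 3
    contribute at most like degree 3; the last summand is the surplus of degree 2. *)
Lemma degree_series_near_1 h : 0 <= h <= 1 ->
  (1 - PSeries d (1 - h)) / mean_degree d <=
  h - h ^ 2 + h ^ 3 / 3 + 2 * d 2%nat / mean_degree d * (h ^ 2 / 2 - h ^ 3 / 3).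
Proof.
intros Hh. assert (Hm := mean_degree_ge_1).
set (m := h - h ^ 2 + h ^ 3 / 3).
assert (S1 := is_series_sub _ _ _ _
  (is_series_scal_r m _ _ (degree_derive_correct 1 ltac:(lra)))
  (is_series_sub _ _ _ _ (nonneg_series_correct d 1 degree_nonneg_series ltac:(lra))
     (nonneg_series_correct d (1 - h) degree_nonneg_series ltac:(lra)))).
apply (is_series_ge_term _ _ 2) in S1.
- rewrite degree_series_1 in S1. change (PSeries (PS_derive d) 1) with (mean_degree d) in S1.
  simpl in S1.
  apply Rmult_le_reg_r with (mean_degree d); [lra|].
  replace ((1 - PSeries d (1 - h)) / mean_degree d * mean_degree d)
    with (1 - PSeries d (1 - h)) by (field; lra).
  replace ((m + 2 * d 2%nat / mean_degree d * (h ^ 2 / 2 - h ^ 3 / 3)) * mean_degree d)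
    with (mean_degree d * m + d 2%nat * (h ^ 2 - 2 * h ^ 3 / 3)) by (field; lra).
  unfold m in *. nra.
- intros n Hn. destruct n as [|[|[|n]]];
    [rewrite (dd_degree_pos _ Hd); lra | rewrite Hd1; lra | lia|].
  generalize (one_minus_pow_le h n Hh) (dd_nonneg _ Hd (3 + n)%nat).
  change (S (S (S n))) with (3 + n)%nat. fold m. rewrite !pow1. intros H H0.
  replace (INR (3 + n) * d (3 + n)%nat * 1 * m - (d (3 + n)%nat * 1 - d (3 + n)%nat * (1 - h) ^ (3 + n)))
    with (d (3 + n)%nat * (INR (3 + n) * m - (1 - (1 - h) ^ (3 + n)))) by ring.
  apply Rmult_le_pos; lra.
Qed.

End NoDegreeOne.

End DegreeDistribution.

(** * Graph reduction *)

(* Fixed point [a] of the accumulator recursion [a = (1 - r) + r * D(x) * a],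
   where [D] is the node distribution: for [r = 1 - p] it is the message [x0] as
   a function of [x = x4], for [r = p] it is [1 - x3] as a function of
   [x = 1 - x1]. [reduced_edge] absorbs the accumulator into the nodes. *)
Definition accumulator_gain (r : R) (d : nat -> R) (x : R) : R :=
  (1 - r) / (1 - r * PSeries d x).

Definition reduced_edge (r : R) (d : nat -> R) (x : R) : R :=
  accumulator_gain r d x * accumulator_gain r d x * edge_series d x.

(** With [a] the gain and [D] the series of [d], [a' = r / (1 - r) * a ^ 2 * D'], so this is an
    antiderivative of [reduced_edge r d]. *)
Definition reduced_primitive (r : R) (d : nat -> R) (x : R) : R :=
  (1 - r) / (r * mean_degree d) * accumulator_gain r d x.

Lemma quadratic_expansion_const c : 0 <= c -> quadratic_expansion (fun _ => c) c 0.
Proof.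
intros Hc. split; [exact Hc | split; [lra|]]. exists (fun _ => 0).
split; [intros; lra | split; [intros; lra | intros; ring]].
Qed.

Lemma quadratic_expansion_at_0 g a0 a1 : quadratic_expansion g a0 a1 -> g 0 = a0.
Proof. intros (_ & _ & k & _ & _ & Hg). rewrite Hg by lra. ring. Qed.

Section ReducedEdge.

Variables (r : R) (d : nat -> R).
Hypothesis Hr : 0 < r < 1.
Hypothesis Hd : degree_distribution d.

Let D := PSeries d.
Let acc := accumulator_gain r d.
Let m := mean_degree d.

Lemma accumulator_denom x : 0 <= x <= 1 -> 1 - r <= 1 - r * D x <= 1.
Proof.
intros Hx. destruct (degree_series_unit d Hd x Hx) as [H0 H1]. fold D in H0, H1. split; nra.
Qed.

Lemma accumulator_gain_1 : acc 1 = 1.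
Proof.
unfold acc, accumulator_gain. rewrite degree_series_1 by exact Hd. field. lra.
Qed.

Lemma accumulator_gain_0 : acc 0 = 1 - r.
Proof.
unfold acc, accumulator_gain. rewrite degree_series_0 by exact Hd. field.
Qed.

Lemma accumulator_gain_fixpoint x : 0 <= x <= 1 -> acc x = (1 - r) + r * D x * acc x.
Proof.
intros Hx. assert (H := accumulator_denom x Hx).
unfold acc, accumulator_gain. fold D. field. lra.
Qed.

(** As [r * D x < 1], a value that the recursion does not raise lies above the fixed point;
    [accumulator_gain_ge] is the dual. *)
Lemma accumulator_gain_le x y : 0 <= x <= 1 ->
  (1 - r) + r * D x * y <= y -> acc x <= y.
Proof.
intros Hx Hy. assert (H := accumulator_denom x Hx).
unfold acc, accumulator_gain. fold D.
apply Rmult_le_reg_r with (1 - r * D x); [lra|].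
unfold Rdiv. rewrite Rmult_assoc, Rinv_l by lra. lra.
Qed.

Lemma accumulator_gain_ge x y : 0 <= x <= 1 ->
  y <= (1 - r) + r * D x * y -> y <= acc x.
Proof.
intros Hx Hy. assert (H := accumulator_denom x Hx).
unfold acc, accumulator_gain. fold D.
apply Rmult_le_reg_r with (1 - r * D x); [lra|].
unfold Rdiv. rewrite Rmult_assoc, Rinv_l by lra. lra.
Qed.

Lemma accumulator_gain_pos x : 0 <= x <= 1 -> 0 < acc x.
Proof.
intros Hx. assert (H := accumulator_denom x Hx).
apply Rdiv_lt_0_compat; [lra|]. fold D. lra.
Qed.

Lemma accumulator_gain_increasing x y : 0 <= x <= y -> y <= 1 -> acc x <= acc y.
Proof.
intros Hx Hy. apply accumulator_gain_le; [lra|].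
rewrite (accumulator_gain_fixpoint y) at 2 by lra.
apply Rplus_le_compat_l, Rmult_le_compat_r.
- apply Rlt_le, accumulator_gain_pos; lra.
- apply Rmult_le_compat_l; [lra|]. now apply degree_series_increasing.
Qed.

Lemma accumulator_gain_bounds x : 0 <= x <= 1 -> 1 - r <= acc x <= 1.
Proof.
intros Hx. split.
- rewrite <- accumulator_gain_0. apply accumulator_gain_increasing; lra.
- rewrite <- accumulator_gain_1. apply accumulator_gain_increasing; lra.
Qed.

(** The recursion does not raise the value on the chord, so the gain lies below it. *)
Lemma chord_to_1_accumulator : chord_to_1 acc.
Proof.
intros x t Hx Ht.
assert (Hy := chord_point x t Hx Ht).
assert (HD := chord_to_1_PSeries d (degree_nonneg_series d Hd) x t Hx Ht).
rewrite degree_series_1 in HD by exact Hd. rewrite accumulator_gain_1.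
apply accumulator_gain_le; [lra|]. fold D in HD.
set (Dy := D ((1 - t) * x + t)) in *.
assert (E := accumulator_gain_fixpoint x Hx).
assert (Hb := accumulator_gain_bounds x Hx).
destruct (degree_series_unit d Hd x Hx) as [HD0 HD1]. fold D in HD0, HD1.
set (c := acc x) in *.
assert (H1 : r * Dy * ((1 - t) * c + t * 1) <= r * ((1 - t) * D x + t) * ((1 - t) * c + t * 1)).
{ apply Rmult_le_compat_r; [nra|]. apply Rmult_le_compat_l; lra. }
assert (H2 : 0 <= r * (t * (1 - t) * ((1 - c) * (1 - D x)))).
{ repeat apply Rmult_le_pos; lra. }
assert (H3 : (1 - t) * c = (1 - t) * ((1 - r) + r * D x * c)) by (f_equal; exact E).
nra.
Qed.

(** Substituting the fixed-point equation into itself gives [(1 - r) + r * (1 - r) * D x + r ^ 2 * D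
    x ^ 2 * acc x]; with [D x = x * (d 1 + x * k x)] both witnesses can be read off. *)
Lemma quadratic_expansion_accumulator : exists a1, quadratic_expansion acc (1 - r) a1.
Proof.
destruct (quadratic_expansion_PSeries d (degree_nonneg_series d Hd))
  as (_ & Hd1 & k & Hk & Hkk & HD).
rewrite (dd_degree_pos _ Hd) in HD.
exists (r * (1 - r) * d 1%nat).
split; [lra | split; [repeat apply Rmult_le_pos; lra|]].
exists (fun x => r * (1 - r) * k x + r ^ 2 * ((d 1%nat + x * k x) ^ 2 * acc x)).
split; [|split].
- intros x Hx. specialize (Hk x Hx). assert (Ha := accumulator_gain_pos x Hx).
  apply Rplus_le_le_0_compat; [repeat apply Rmult_le_pos; lra|].
  apply Rmult_le_pos; [apply pow2_ge_0|]. apply Rmult_le_pos; [apply pow2_ge_0 | lra].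
- intros x y Hx Hy.
  assert (Hkx : 0 <= k x <= k y) by (split; [apply Hk; lra | now apply Hkk]).
  assert (Ha := accumulator_gain_pos x ltac:(lra)).
  assert (Haa := accumulator_gain_increasing x y Hx Hy).
  apply Rplus_le_compat; apply Rmult_le_compat_l; try nra.
  assert (0 <= x * k x <= y * k y).
  { split; [apply Rmult_le_pos; lra | apply Rmult_le_compat; lra]. }
  apply Rmult_le_compat; [apply pow2_ge_0 | lra | apply pow_incr; lra | lra].
- intros x Hx. assert (E := accumulator_gain_fixpoint x Hx).
  assert (ED : D x = x * (d 1%nat + x * k x)) by (unfold D; rewrite HD by exact Hx; ring).
  rewrite E at 1. rewrite E at 1. rewrite ED. ring.
Qed.

Lemma reduced_edge_1 : reduced_edge r d 1 = 1.
Proof.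
unfold reduced_edge. fold acc. rewrite accumulator_gain_1, edge_series_1 by exact Hd. ring.
Qed.

Lemma reduced_edge_increasing x y : 0 <= x <= y -> y <= 1 ->
  reduced_edge r d x <= reduced_edge r d y.
Proof.
intros Hx Hy. unfold reduced_edge. fold acc.
assert (Ha := accumulator_gain_pos x ltac:(lra)).
assert (Haa := accumulator_gain_increasing x y Hx Hy).
destruct (edge_series_unit d Hd x ltac:(lra)).
apply Rmult_le_compat; [nra | lra | nra | now apply edge_series_increasing].
Qed.

Lemma reduced_edge_unit x : 0 <= x <= 1 -> 0 <= reduced_edge r d x <= 1.
Proof.
intros Hx. split.
- unfold reduced_edge. fold acc. assert (Ha := accumulator_gain_pos x Hx).
  apply Rmult_le_pos; [nra | now apply edge_series_unit].
- rewrite <- reduced_edge_1. apply reduced_edge_increasing; lra.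
Qed.

Lemma reduced_edge_le_edge x : 0 <= x <= 1 -> reduced_edge r d x <= edge_series d x.
Proof.
intros Hx. unfold reduced_edge. fold acc. assert (Ha := accumulator_gain_bounds x Hx).
destruct (edge_series_unit d Hd x Hx). assert (acc x * acc x <= 1) by nra. nra.
Qed.

Lemma reduced_edge_lt_1 x : 0 <= x < 1 -> reduced_edge r d x < 1.
Proof.
intros Hx. assert (Ha : acc x < 1).
{ rewrite (accumulator_gain_fixpoint x) by lra.
  generalize (degree_series_le_id d Hd x ltac:(lra)) (degree_series_unit d Hd x ltac:(lra))
    (accumulator_gain_bounds x ltac:(lra)). fold D. intros.
  assert (D x * acc x < 1) by nra. nra. }
generalize (accumulator_gain_pos x ltac:(lra)) (edge_series_unit d Hd x ltac:(lra)). intros.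
unfold reduced_edge. fold acc. assert (acc x * acc x < 1) by nra. nra.
Qed.

Lemma reduced_edge_0 : reduced_edge r d 0 = (1 - r) ^ 2 * (d 1%nat / m).
Proof.
unfold reduced_edge. fold acc. rewrite accumulator_gain_0. unfold edge_series.
rewrite PSeries_0. unfold PS_derive at 1. simpl INR. fold m. unfold Rdiv. ring.
Qed.

Lemma reduced_edge_0_le : reduced_edge r d 0 <= (1 - r) ^ 2.
Proof.
unfold reduced_edge. fold acc. rewrite accumulator_gain_0.
destruct (edge_series_unit d Hd 0 ltac:(lra)).
assert (0 <= (1 - r) * (1 - r)) by nra. nra.
Qed.

Lemma chord_to_1_reduced_edge : chord_to_1 (reduced_edge r d).
Proof.
assert (Ha : forall x, 0 <= x <= 1 -> 0 <= acc x <= acc 1).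
{ intros x Hx. rewrite accumulator_gain_1.
  generalize (accumulator_gain_pos x Hx) (accumulator_gain_bounds x Hx). lra. }
apply (chord_to_1_mult (fun x => acc x * acc x) (edge_series d)).
- intros x Hx. destruct (Ha x Hx). split; [nra | apply Rmult_le_compat; lra].
- intros x Hx. rewrite edge_series_1 by exact Hd. now apply edge_series_unit.
- apply (chord_to_1_mult acc acc); [exact Ha | exact Ha | |]; apply chord_to_1_accumulator.
- intros x t Hx Ht. unfold edge_series. fold m.
  assert (Hm := mean_degree_ge_1 d Hd). fold m in Hm.
  apply Rmult_le_reg_r with m; [lra|].
  generalize (chord_to_1_PSeries _ (degree_derive_nonneg_series d Hd) x t Hx Ht). intros H.
  unfold Rdiv. rewrite Rmult_plus_distr_r, !Rmult_assoc, Rinv_l, !Rmult_1_r by lra. exact H.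
Qed.

Lemma quadratic_expansion_reduced_edge :
  exists a1, quadratic_expansion (reduced_edge r d) (reduced_edge r d 0) a1.
Proof.
destruct quadratic_expansion_accumulator as [a1 Ha].
assert (Hm := mean_degree_ge_1 d Hd).
assert (He := quadratic_expansion_mult _ _ _ _ _ _
  (quadratic_expansion_PSeries _ (degree_derive_nonneg_series d Hd))
  (quadratic_expansion_const (/ mean_degree d) ltac:(apply Rlt_le, Rinv_0_lt_compat; lra))).
assert (Hg := quadratic_expansion_mult _ _ _ _ _ _
  (quadratic_expansion_mult _ _ _ _ _ _ Ha Ha) He).
eexists. rewrite <- (quadratic_expansion_at_0 _ _ _ Hg) in Hg. exact Hg.
Qed.

Lemma reduced_edge_slope x y : 0 <= x <= y -> y <= 1 ->
  (1 - r) ^ 2 * (2 * d 2%nat / m) * (y - x) <= reduced_edge r d y - reduced_edge r d x.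
Proof.
intros Hx Hy. unfold reduced_edge. fold acc.
assert (Ha := accumulator_gain_bounds x ltac:(lra)).
assert (Haa := accumulator_gain_increasing x y Hx Hy).
assert (He := edge_series_slope d Hd x y Hx Hy). fold m in He.
destruct (edge_series_unit d Hd x ltac:(lra)) as [He0 _].
assert (H0 : 0 <= 2 * d 2%nat / m * (y - x)).
{ assert (Hm := mean_degree_ge_1 d Hd). fold m in Hm.
  apply Rmult_le_pos; [|lra]. apply Rdiv_le_0_compat; [|lra].
  generalize (dd_nonneg _ Hd 2%nat). lra. }
set (b := 2 * d 2%nat / m * (y - x)) in *.
replace ((1 - r) ^ 2 * (2 * d 2%nat / m) * (y - x)) with ((1 - r) * (1 - r) * b) by (unfold b; ring).
assert (H1 : (1 - r) * (1 - r) * b <= acc x * acc x * b).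
{ apply Rmult_le_compat_r; [exact H0|]. apply Rmult_le_compat; lra. }
assert (H2 : acc x * acc x * (edge_series d x + b) <= acc y * acc y * edge_series d y).
{ apply Rmult_le_compat; [nra | lra | apply Rmult_le_compat; lra | lra]. }
lra.
Qed.

(** Gives areas under the graph without any derivative at the endpoint 1. *)
Lemma reduced_primitive_sub a b : 0 <= a <= 1 -> 0 <= b <= 1 ->
  reduced_primitive r d b - reduced_primitive r d a = acc a * acc b * ((D b - D a) / m).
Proof.
intros Ha Hb.
assert (H1 := accumulator_denom a Ha). assert (H2 := accumulator_denom b Hb).
assert (Hm := mean_degree_ge_1 d Hd). fold m in Hm.
unfold reduced_primitive, acc, accumulator_gain. fold D m. field. repeat split; lra.
Qed.

Lemma reduced_primitive_total :
  reduced_primitive r d 1 - reduced_primitive r d 0 = (1 - r) / m.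
Proof.
rewrite reduced_primitive_sub, accumulator_gain_0, accumulator_gain_1 by lra.
unfold D. rewrite degree_series_0, degree_series_1 by exact Hd. unfold Rdiv. ring.
Qed.

(** Counterpart of [slope_bound_area] for a lower slope bound, valid up to [b = 1]: raising the gain
    at [a] to the gain at [b] reduces it to [degree_tangent_gap]. *)
Lemma reduced_primitive_strip a b : 0 <= a <= b -> b <= 1 ->
  (1 - r) ^ 2 * (2 * d 2%nat / m) * (b - a) ^ 2 / 2 <=
  reduced_edge r d b * (b - a) - (reduced_primitive r d b - reduced_primitive r d a).
Proof.
intros Ha Hb. rewrite reduced_primitive_sub by lra.
assert (Hm := mean_degree_ge_1 d Hd). fold m in Hm.
assert (Hg := degree_tangent_gap d Hd a b Ha Hb).
assert (Hac := accumulator_gain_bounds b ltac:(lra)).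
assert (Haa := accumulator_gain_increasing a b Ha Hb).
assert (Hap := accumulator_gain_pos a ltac:(lra)).
unfold reduced_edge, edge_series. fold acc m D in Hg |- *.
set (D1 := PSeries (PS_derive d) b) in *. set (g := acc b) in *.
assert (H0 : 0 <= d 2%nat * (b - a) ^ 2).
{ apply Rmult_le_pos; [apply (dd_nonneg _ Hd) | apply pow2_ge_0]. }
assert (HD : 0 <= D b - D a).
{ generalize (degree_series_increasing d Hd a b Ha Hb). fold D. lra. }
apply Rmult_le_reg_r with m; [lra|].
replace ((1 - r) ^ 2 * (2 * d 2%nat / m) * (b - a) ^ 2 / 2 * m)
  with ((1 - r) * (1 - r) * (d 2%nat * (b - a) ^ 2)) by (field; lra).
replace ((g * g * (D1 / m) * (b - a) - acc a * g * ((D b - D a) / m)) * m)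
  with (g * g * (D1 * (b - a)) - acc a * g * (D b - D a)) by (field; lra).
assert (acc a * g * (D b - D a) <= g * g * (D b - D a)).
{ apply Rmult_le_compat_r; [exact HD|]. apply Rmult_le_compat_r; lra. }
assert ((1 - r) * (1 - r) * (d 2%nat * (b - a) ^ 2)
  <= g * g * (D1 * (b - a) - (D b - D a))).
{ apply Rmult_le_compat; [nra | exact H0 | apply Rmult_le_compat; lra | exact Hg]. }
lra.
Qed.

Lemma reduced_primitive_derive x : 0 <= x < 1 ->
  is_derive (reduced_primitive r d) x (reduced_edge r d x).
Proof.
intros Hx. assert (Hden := accumulator_denom x ltac:(lra)).
assert (Hm := mean_degree_ge_1 d Hd).
assert (HD : is_derive D x (PSeries (PS_derive d) x)).
{ apply is_derive_PSeries. rewrite Rabs_pos_eq by lra.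
  apply Rbar_lt_le_trans with 1; [simpl; lra | now apply degree_cv_radius]. }
unfold reduced_primitive, accumulator_gain. fold D.
assert (E : is_derive (fun x => (1 - r) / (r * mean_degree d) * ((1 - r) / (1 - r * D x))) x
  ((1 - r) / (r * mean_degree d) * ((1 - r) * (r * Derive D x / (1 - r * D x) ^ 2)))).
{ auto_derive.
  - split; [eexists; exact HD | split; [lra | exact I]].
  - change (Derive (fun x => D x) x) with (Derive D x). field. lra. }
rewrite (is_derive_unique _ _ _ HD) in E.
replace (reduced_edge r d x) with
  ((1 - r) / (r * mean_degree d) * ((1 - r) * (r * PSeries (PS_derive d) x / (1 - r * D x) ^ 2))).
- exact E.
- unfold reduced_edge, accumulator_gain, edge_series. fold D. field. lra.
Qed.

End ReducedEdge.

(** * Staircases *)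

Lemma decreasing_lower_bound (u e : nat -> R) :
  (forall n, u (S n) <= u n) -> (forall n, e n <= u n) -> is_lim_seq e 0 ->
  forall n, 0 <= u n.
Proof.
intros Hu He Hlim n.
assert (Hd : forall k, u (k + n)%nat <= u n).
{ induction k as [|k IH]; [apply Rle_refl|]. simpl. eapply Rle_trans; [apply Hu | exact IH]. }
apply is_lim_seq_incr_n with (N := n) in Hlim.
apply (is_lim_seq_le _ (fun _ => u n) 0 (u n)) with (2 := Hlim).
- intros k. eapply Rle_trans; [apply He | apply Hd].
- apply is_lim_seq_const.
Qed.

Section Staircase.

(** [V n] is the level after [n] steps, [K n] the area still ahead, [e] a minorant of [K], [A] the
    area of the first step on the side of [f], and [th] a lower bound on the ratio of consecutive
    step heights. *)
Variables (K V e : nat -> R) (s A th : R).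
Let h n := V n - V (S n).
Hypothesis Hs : 0 <= s.
Hypothesis Hth : 0 <= th < 1.
Hypothesis Hh : forall n, 0 <= h n.
Hypothesis Hratio : forall n, th * h n <= h (S n).
Hypothesis HV : is_lim_seq V 0.
Hypothesis He : is_lim_seq e 0.
Hypothesis HKe : forall n, e n <= K n.
Hypothesis HK0 : A + s * h 1%nat ^ 2 / 2 <= K 0%nat - K 1%nat.
Hypothesis HK : forall n, s * h (S n) ^ 2 / 2 + s * h (S (S n)) ^ 2 / 2 <= K (S n) - K (S (S n)).
Hypothesis HA : s * h 0%nat ^ 2 <= (1 + th ^ 2) * A.

(** Step [n] yields triangles of heights [h n] and [h (S n)]. Discounting the former in advance
    leaves [s * h (S n) ^ 2] per step; for [n = 0], [A] stands in for it. *)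
Let E n := match n with O => K 0%nat - A | S _ => K n - s * h n ^ 2 / 2 end.

Lemma staircase_excess_step n : s * h (S n) ^ 2 <= E n - E (S n).
Proof.
destruct n as [|n]; simpl.
- simpl in HK0. lra.
- generalize (HK n). simpl. lra.
Qed.

Lemma staircase_step_lim : is_lim_seq h 0.
Proof.
replace (Finite 0) with (Finite (0 - 0)) by (f_equal; ring).
apply is_lim_seq_minus'; [exact HV|].
now apply (is_lim_seq_incr_1 V).
Qed.

(* The steps decay at most geometrically, so the last one bounds the area that
   remains: [sum_(j >= 1) th^(2j) = th^2 / (1 - th^2)]. *)
Lemma staircase_excess_tail n : s * th ^ 2 * h n ^ 2 <= (1 - th ^ 2) * E n.
Proof.
assert (Hth2 : 0 <= 1 - th ^ 2) by nra.
(* Shifted by one because [E 0] has a form of its own; [u] is non-increasing with a minorant tending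
   to 0. *)
set (u n := (1 - th ^ 2) * E (S n) - s * th ^ 2 * h (S n) ^ 2).
assert (Hu : forall n, (1 - th ^ 2) * E (S n) - s * th ^ 2 * h (S n) ^ 2
                      <= (1 - th ^ 2) * E n - s * th ^ 2 * h n ^ 2).
{ intros k.
  assert (H1 := Rmult_le_compat_l _ _ _ Hth2 (staircase_excess_step k)).
  assert (H2 : s * (th * h k) ^ 2 <= s * h (S k) ^ 2).
  { apply Rmult_le_compat_l; [exact Hs|]. apply pow_incr. split; [|apply Hratio].
    apply Rmult_le_pos; [lra | apply Hh]. }
  rewrite Rpow_mult_distr in H2. lra. }
assert (Hpos : 0 <= u n).
{ apply (decreasing_lower_bound u
    (fun n => (1 - th ^ 2) * (e (S n) - s / 2 * (h (S n) * h (S n))) - s * th ^ 2 * (h (S n) * h (S n)))).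
  - intros k; apply Hu.
  - intros k; unfold u, E. apply Rplus_le_compat; [| apply Ropp_le_contravar; right; ring].
    apply Rmult_le_compat_l; [exact Hth2|]. generalize (HKe (S k)). lra.
  - assert (Hh0 : is_lim_seq (fun n => h (S n)) 0) by (apply -> is_lim_seq_incr_1; apply staircase_step_lim).
    assert (He0 : is_lim_seq (fun n => e (S n)) 0) by (now apply -> is_lim_seq_incr_1).
    assert (Hhh : is_lim_seq (fun n => h (S n) * h (S n)) (0 * 0)) by (now apply is_lim_seq_mult').
    replace (Finite 0) with (Finite ((1 - th ^ 2) * (0 - s / 2 * (0 * 0)) - s * th ^ 2 * (0 * 0)))
      by (f_equal; ring).
    apply is_lim_seq_minus'.
    + apply (is_lim_seq_scal_l _ (1 - th ^ 2) (Finite (0 - s / 2 * (0 * 0)))).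
      apply is_lim_seq_minus'; [exact He0|].
      now apply (is_lim_seq_scal_l _ (s / 2) (Finite (0 * 0))).
    + now apply (is_lim_seq_scal_l _ (s * th ^ 2) (Finite (0 * 0))). }
unfold u in Hpos. generalize (Hu n). lra.
Qed.

(** Cauchy-Schwarz in tangent form: [x ^ 2 = 2 * m * x - m ^ 2 + (x - m) ^ 2] is summed over the
    heights, and only the last square is kept. *)
Lemma staircase_excess_sum m n :
  s * (2 * m * (V 1%nat - V (S (S n))) - INR (S n) * m ^ 2 + (h (S n) - m) ^ 2) <= E 0%nat - E (S n).
Proof.
induction n as [|n IH].
- generalize (staircase_excess_step 0). unfold h; simpl INR. intros H.
  eapply Rle_trans; [| exact H]. right; ring.
- generalize (staircase_excess_step (S n)). intros H.
  assert (0 <= s * (h (S n) - m) ^ 2) by (apply Rmult_le_pos; [exact Hs | apply pow2_ge_0]).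
  replace (s * h (S (S n)) ^ 2) with
    (s * (2 * m * (V (S (S n)) - V (S (S (S n)))) - m ^ 2 + (h (S (S n)) - m) ^ 2)) in H
    by (unfold h; ring).
  rewrite (S_INR (S n)). lra.
Qed.

Lemma staircase_area l : (1 <= l)%nat -> s * (V 0%nat - V l) ^ 2 <= INR l * K 0%nat.
Proof.
intros Hl. destruct l as [|n]; [lia|]. clear Hl.
set (H := V 0%nat - V (S n)).
assert (HN : 0 < INR (S n)) by (apply lt_0_INR; lia).
set (m := H / INR (S n)).
assert (HmH : INR (S n) * m = H) by (unfold m; field; lra).
assert (Hsum : s * (2 * m * H - INR (S n) * m ^ 2 + (h 0%nat - m) ^ 2 + (h n - m) ^ 2)
   - s * h 0%nat ^ 2 + E n <= E 0%nat \/ n = 0%nat).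
{ destruct n as [|n]; [now right | left].
  generalize (staircase_excess_sum m n). rewrite (S_INR (S n)). unfold H, h. intros. lra. }
(* The first height is paid for by [A], by the area left at the end and by the variance of the first
   and last heights. *)
assert (Hopt : s * h 0%nat ^ 2 <= A + E n + s * (h 0%nat - h n) ^ 2 / 2).
{ generalize (staircase_excess_tail n). set (y := h n). set (x := h 0%nat) in *. intros Ht.
  assert (Hpos : 0 < 1 - th ^ 2) by nra.
  assert (Hpos' : 0 < 1 + th ^ 2) by nra.
  apply Rmult_le_reg_l with ((1 - th ^ 2) * (1 + th ^ 2)); [nra|].
  assert (H1 := Rmult_le_compat_l _ _ _ (Rlt_le _ _ Hpos') Ht).
  assert (H2 := Rmult_le_compat_l _ _ _ (Rlt_le _ _ Hpos) HA).
  (* Once the bounds on [A] and [E n] are inserted, the two sides differ by exactly half of this. *)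
  assert (H3 : 0 <= s * ((1 + th ^ 2) * y - (1 - th ^ 2) * x) ^ 2).
  { apply Rmult_le_pos; [exact Hs | apply pow2_ge_0]. }
  nra. }
assert (HE0 : K 0%nat = A + E 0%nat) by (unfold E; ring).
assert (Hfin : s * (m * H) <= K 0%nat).
{ destruct Hsum as [Hsum | ->].
  (* [(h 0 - m) ^ 2 + (h n - m) ^ 2] exceeds [(h 0 - h n) ^ 2 / 2] by half of the square below. *)
  - assert (0 <= s * ((h 0%nat - m) - (m - h n)) ^ 2) by (apply Rmult_le_pos; [exact Hs | apply pow2_ge_0]).
    rewrite HE0. replace (INR (S n) * m ^ 2) with (m * H) in Hsum by (rewrite <- HmH; ring). nra.
  - rewrite HE0. unfold m, H in *. simpl INR. unfold h in Hopt. simpl INR in *.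
    replace ((V 0%nat - V 1%nat) / 1 * (V 0%nat - V 1%nat)) with ((V 0%nat - V 1%nat) ^ 2) by field. lra. }
replace (s * H ^ 2) with (INR (S n) * (s * (m * H))) by (rewrite <- HmH; ring).
apply Rmult_le_compat_l; lra.
Qed.

End Staircase.

(** * Elementary inequalities for the first step *)

(** Here [s <= 1 / 2], and the first strip alone covers [s * h ^ 2]. The factor of [s] and the
    right-hand side are [den] and [num] in [first_strip_area]. *)
Lemma strip_bound_small_p p lam h : let q := 1 - p in let s := p^2 * lam in
  0 < p < 1 -> p ^ 2 <= 1/2 -> 0 <= lam <= 1 -> 0 <= h <= q^2 ->
  s * (p + q * h * (2 - h)) <= p * ((2 - lam) / 2 - (1 - lam) * h / 3) + q * (2 - h).
Proof.
intros q s Hp Hp2 Hl Hh.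
assert (Hq : 0 < q < 1) by (unfold q; lra).
assert (Hh1 : h <= 1) by nra.
assert (Hs : 0 <= s <= 1 / 2) by (unfold s; nra).
assert ((1 - lam) * h <= 1 - lam) by nra.
assert (s * p <= p * ((2 - lam) / 2 - (1 - lam) * h / 3)) by nra.
assert (0 <= q * (2 - h)) by nra.
assert (s * h <= 1) by nra.
nra.
Qed.

(** Shows that the strip covers [c * h ^ 2] with [c = 1 - lam / 2 + 3 / 2 * q]; the factor
    [1 + th ^ 2] then makes up for [c] being possibly smaller than [s], by [ratio_bound_large_p]. *)
Lemma strip_bound_large_p p lam h : let q := 1 - p in
  0 < p < 1 -> 1/2 < p ^ 2 -> 0 <= lam <= 1 -> 0 <= h <= q^2 ->
  (1 - lam / 2 + 3 / 2 * q) * (p + q * h * (2 - h)) <= p * ((2 - lam) / 2 - (1 - lam) * h / 3) + q * (2 - h).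
Proof.
intros q Hp Hp2 Hl Hh.
assert (Hq : 0 < q < 3 / 10) by (unfold q; nra).
replace p with (1 - q) in * by (unfold q; ring). clearbody q. clear Hp.
assert (Hh1 : h <= 9 / 100) by nra.
set (M := 1 - lam / 2). assert (HM : 1/2 <= M <= 1) by (unfold M; lra).
replace ((2 - lam) / 2) with M by (unfold M; field).
assert (E : 0 <= q * (2 - h - M * h * (2 - h) - 3 / 2 * (1 - q) - 3 / 2 * q * h * (2 - h)) - (1 - q) * ((1 - lam) * h / 3)); [| nra].
assert (H1 : (1 - q) * ((1 - lam) * h / 3) <= q * (q / 3)).
{ assert ((1 - lam) * h <= q ^ 2) by nra. nra. }
assert (H2 : 0 <= h * (2 - h) <= 18/100) by nra.
assert (H3 : M * (h * (2 - h)) <= 18/100) by nra.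
assert (H4 : q * (h * (2 - h)) <= 6/100) by nra.
nra.
Qed.

Lemma ratio_bound_large_p p lam h : let q := 1 - p in let s := p^2 * lam in
  let th := Rmax 0 (2 * s * (1 - h) - 1) in
  0 < p < 1 -> 1/2 < p ^ 2 -> 0 <= lam <= 1 -> 0 <= h <= q^2 ->
  s <= (1 + th ^ 2) * (1 - lam / 2 + 3 / 2 * q).
Proof.
intros q s th Hp Hp2 Hl Hh.
assert (Hq : 0 < q < 3 / 10) by (unfold q; nra).
assert (Hs : 0 <= s <= p ^ 2) by (unfold s; nra).
assert (HM : 1 - s / 2 + q / 2 <= 1 - lam / 2 + 3 / 2 * q).
{ enough (lam * (1 - p ^ 2) <= 2 * q) by (unfold s; lra). assert (lam * (1 - p ^ 2) <= 1 * (1 - p ^ 2)) by (apply Rmult_le_compat_r; nra).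
  unfold q; nra. }
assert (Hth : 0 <= th ^ 2) by nra.
apply Rle_trans with ((1 + th ^ 2) * (1 - s / 2 + q / 2)); [| apply Rmult_le_compat_l; lra].
assert (Hp3 : p ^ 2 <= 1 - q) by (unfold q; nra).
unfold th, Rmax; destruct Rle_dec as [Hc | Hc].
- set (t0 := 2 * s - 1).
  assert (Ht0 : 0 <= t0) by (unfold t0; nra).
  assert (H1 : t0 ^ 2 - 4 * s * h * t0 <= (2 * s * (1 - h) - 1) ^ 2) by (unfold t0; nra).
  assert (Hs1 : 1/2 <= s) by (unfold t0 in Ht0; lra).
  assert (H2 : 4 * s * h * t0 <= q / 2).
  { assert (s * t0 <= p^2 * (2 * p ^2 - 1)) by (unfold t0; nra).
    assert (0 <= s * t0) by nra.
    assert (4 * (s * t0) * h <= 4 * (p^2 * (2 * p ^2 - 1)) * q^2).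
    { apply Rmult_le_compat; nra. }
    assert (p^2 * (2 * p ^2 - 1) * q <= 1/8).
    { assert (p^2 * (2 * p ^2 - 1) <= (1 - q) * (1 - 2 * q)) by (apply Rmult_le_compat; lra).
      assert (q * (1 - 2 * q) <= 1 / 8) by (assert (0 <= (q - 1/4) ^ 2) by apply pow2_ge_0; lra).
      assert ((q * (1 - 2 * q)) * (1 - q) <= 1 / 8 * 1) by (apply Rmult_le_compat; nra).
      nra. }
    nra. }
  (* For [h = 0] and without the terms in [q], the claim is this identity, tight at [s = 1]; the
     terms in [q] absorb [h <= q ^ 2]. *)
  assert (H3 : (1 + t0 ^ 2) * (1 - s / 2) - s = 2 * (1 - s) ^ 3) by (unfold t0; field).
  assert (0 <= (1 - s) ^ 3) by (apply pow_le; nra).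
  assert (H5 : (1 + t0^2 - q/2) * (1 - s / 2 + q / 2) <= (1 + (2 * s * (1 - h) - 1) ^ 2) * (1 - s / 2 + q / 2)).
  { apply Rmult_le_compat_r; lra. }
  assert (H6 : 0 <= q / 2 * (t0 ^ 2 + (s - q) / 2)).
  { apply Rmult_le_pos; [lra|]. assert (0 <= t0 ^ 2) by apply pow2_ge_0. lra. }
  lra.
- assert (s * (1 - h) <= 1 / 2) by lra.
  assert (h <= 9 / 100) by nra. nra.
Qed.

(** * The staircase of the reduced recursion *)

Section ReducedEvolution.

Variables (p : R) (L Rc : nat -> R).
Hypothesis Hp : 0 < p < 1.
Hypothesis HL : degree_distribution L.
Hypothesis HR : degree_distribution Rc.

Let f := reduced_edge (1 - p) L.
Let g := reduced_edge p Rc.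
Let q_unit : 0 < 1 - p < 1.
Proof. lra. Qed.

Definition reduced_step (v : R) : R := 1 - reduced_edge p Rc (1 - reduced_edge (1 - p) L v).

Definition reduced_evolution (n : nat) : R := Nat.iter n reduced_step 1.

Let V := reduced_evolution.
Let X n := 1 - f (V n).

Lemma reduced_step_unit v : 0 <= v <= 1 -> 0 <= reduced_step v <= 1.
Proof.
intros Hv. destruct (reduced_edge_unit _ L q_unit HL v Hv).
destruct (reduced_edge_unit p Rc Hp HR (1 - reduced_edge (1 - p) L v) ltac:(lra)).
unfold reduced_step. lra.
Qed.

Lemma reduced_step_increasing v w : 0 <= v <= w -> w <= 1 -> reduced_step v <= reduced_step w.
Proof.
intros Hv Hw. destruct (reduced_edge_unit _ L q_unit HL v ltac:(lra)).
destruct (reduced_edge_unit _ L q_unit HL w ltac:(lra)).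
generalize (reduced_edge_increasing _ L q_unit HL v w Hv Hw). intros.
unfold reduced_step.
generalize (reduced_edge_increasing p Rc Hp HR
  (1 - reduced_edge (1 - p) L w) (1 - reduced_edge (1 - p) L v) ltac:(lra) ltac:(lra)). lra.
Qed.

Lemma reduced_evolution_unit n : 0 <= V n <= 1.
Proof.
induction n as [|n IH]; [unfold V; simpl; lra | exact (reduced_step_unit (V n) IH)].
Qed.

Lemma reduced_evolution_S n : V (S n) = 1 - g (X n).
Proof. reflexivity. Qed.

Lemma reduced_evolution_decreasing n : V (S n) <= V n.
Proof.
induction n as [|n IH].
- apply (reduced_evolution_unit 1).
- apply (reduced_step_increasing (V (S n)) (V n)); [|apply reduced_evolution_unit].
  split; [apply reduced_evolution_unit | exact IH].
Qed.

Lemma reduced_channel_unit n : 0 <= X n <= 1.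
Proof.
unfold X. destruct (reduced_edge_unit _ L q_unit HL (V n) (reduced_evolution_unit n)).
fold f in H, H0. lra.
Qed.

Hypothesis HL2 : 0 < L 2%nat.
Hypothesis Hlim : is_lim_seq V 0.

Let lam := 2 * L 2%nat / mean_degree L.
Let s := p ^ 2 * lam.
Let h0 := g 0.
Let th := Rmax 0 (2 * s * (1 - h0) - 1).

Let Hf v w : 0 <= v <= w -> w <= 1 -> s * (w - v) <= f w - f v.
Proof.
intros Hv Hw. generalize (reduced_edge_slope _ L q_unit HL v w Hv Hw).
unfold s, lam. replace (1 - (1 - p)) with p by ring. auto.
Qed.

(** If [v] were raised, then by monotonicity the iterates from 1 could not fall below its image,
    against the limit 0. *)
Lemma reduced_step_le_id v : 0 <= v <= 1 -> reduced_step v <= v.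
Proof.
intros Hv. apply Rnot_lt_le. intros Hlt.
assert (Hs := reduced_step_unit v Hv).
assert (Hn : forall n, reduced_step v <= V n).
{ induction n as [|n IH]; [apply Hs|].
  apply (reduced_step_increasing v (V n)); [lra | apply reduced_evolution_unit]. }
assert (H := is_lim_seq_le _ _ _ _ Hn (is_lim_seq_const _) Hlim). simpl in H. lra.
Qed.

(** Nodes of degree 1 would make [f 0], and hence [reduced_step 0], positive. *)
Lemma no_degree_one : L 1%nat = 0.
Proof.
assert (H := reduced_step_le_id 0 ltac:(lra)). unfold reduced_step in H. fold f g in H.
destruct (reduced_edge_unit _ L q_unit HL 0 ltac:(lra)) as [H0 H1]. fold f in H0, H1.
destruct (Rle_lt_or_eq_dec _ _ H0) as [Hpos | Hz].
- generalize (reduced_edge_lt_1 p Rc Hp HR (1 - f 0) ltac:(lra)). fold g. lra.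
- unfold f in Hz. rewrite reduced_edge_0 in Hz by assumption.
  assert (Hm := mean_degree_ge_1 L HL).
  symmetry in Hz. apply Rmult_integral in Hz. destruct Hz as [Hz | Hz].
  + assert (0 < (1 - (1 - p)) ^ 2) by (apply pow_lt; lra). lra.
  + replace (L 1%nat) with (L 1%nat / mean_degree L * mean_degree L) by (field; lra).
    rewrite Hz. ring.
Qed.

Lemma degree_two_fraction : 0 < lam <= 1.
Proof.
assert (Hm := mean_degree_ge_1 L HL). unfold lam. split.
- apply Rdiv_lt_0_compat; lra.
- generalize (edge_series_slope L HL 0 1 ltac:(lra) ltac:(lra)).
  rewrite edge_series_1 by exact HL. destruct (edge_series_unit L HL 0 ltac:(lra)). lra.
Qed.

Lemma reduced_slope_pos : 0 < s < 1.
Proof.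
generalize degree_two_fraction. intros Hlam.
assert (0 < p ^ 2 < 1) by (split; nra). unfold s. split; nra.
Qed.

Lemma reduced_edge_id_bounds v : 0 <= v <= 1 -> s * v <= f v <= v.
Proof.
intros Hv. split.
- generalize (Hf 0 v ltac:(lra) ltac:(lra)). destruct (reduced_edge_unit _ L q_unit HL 0 ltac:(lra)).
  fold f in H. lra.
- eapply Rle_trans; [now apply reduced_edge_le_edge|].
  apply edge_series_le_id; [exact HL | exact no_degree_one | exact Hv].
Qed.

(** The [v] with [s * v = 1 - x] is not raised by a step, and [1 - f v <= x]. If this [v] exceeds 1,
    then [1 - x > s] suffices. *)
Lemma reduced_check_line x : 0 <= x <= 1 -> s * (1 - g x) <= 1 - x.
Proof.
intros Hx. assert (Hs := reduced_slope_pos).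
destruct (Rle_lt_dec (1 - x) s) as [Hle | Hlt].
- set (v := (1 - x) / s).
  assert (Hsv : s * v = 1 - x) by (unfold v; field; lra).
  assert (Hv : 0 <= v <= 1).
  { split; [apply Rdiv_le_0_compat; lra|]. apply Rmult_le_reg_l with s; lra. }
  assert (H := reduced_step_le_id v Hv). unfold reduced_step in H. fold f g in H.
  assert (Hfv := reduced_edge_id_bounds v Hv).
  generalize (reduced_edge_increasing p Rc Hp HR (1 - f v) x ltac:(lra) ltac:(lra)). fold g. intros.
  rewrite <- Hsv. apply Rmult_le_compat_l; lra.
- destruct (reduced_edge_unit p Rc Hp HR x Hx) as [H0 _]. fold g in H0. nra.
Qed.

Lemma reduced_check_slope x y : 0 <= x <= y -> y <= 1 -> s * (g y - g x) <= y - x.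
Proof.
apply chord_to_1_slope.
- now apply chord_to_1_reduced_edge.
- now apply reduced_edge_1.
- apply reduced_slope_pos.
- exact reduced_check_line.
Qed.

(** Keeps every [X n] below 1, where [reduced_primitive_derive] applies. *)
Lemma reduced_evolution_pos n : 0 < V n.
Proof.
induction n as [|n IH]; [unfold V; simpl; lra|].
rewrite reduced_evolution_S.
assert (Hs := reduced_slope_pos).
assert (Hb := reduced_edge_id_bounds (V n) (reduced_evolution_unit n)).
assert (Hx := reduced_channel_unit n).
generalize (reduced_edge_lt_1 p Rc Hp HR (X n)). fold g. intros H.
enough (g (X n) < 1) by lra. apply H. split; [lra|]. unfold X. nra.
Qed.

Lemma reduced_channel_lt_1 n : X n < 1.
Proof.
assert (Hs := reduced_slope_pos). assert (Hv := reduced_evolution_pos n).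
assert (Hb := reduced_edge_id_bounds (V n) (reduced_evolution_unit n)).
unfold X. nra.
Qed.

Lemma reduced_channel_step n :
  s * (V n - V (S n)) <= X (S n) - X n.
Proof.
unfold X. generalize (Hf (V (S n)) (V n)
  (conj (proj1 (reduced_evolution_unit (S n))) (reduced_evolution_decreasing n))
  (proj2 (reduced_evolution_unit n))). lra.
Qed.

Lemma reduced_channel_increasing n : X n <= X (S n).
Proof.
generalize (reduced_channel_step n) (reduced_evolution_decreasing n) reduced_slope_pos.
intros. nra.
Qed.

Lemma initial_erasure_bounds : 0 <= h0 <= (1 - p) ^ 2.
Proof.
split.
- apply reduced_edge_unit; lra || assumption.
- now apply reduced_edge_0_le.
Qed.

Lemma initial_step : V 0%nat - V 1%nat = h0.
Proof.
rewrite reduced_evolution_S. unfold h0, X. change (V 0%nat) with 1.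
unfold f. rewrite reduced_edge_1 by assumption. replace (1 - 1) with 0 by ring. ring.
Qed.

(** The slope of [f] is at least [s], and that of [g] at least its linear coefficient, which is at
    least [2 * (1 - h0) - / s]. *)
Lemma step_ratio n : th * (V n - V (S n)) <= V (S n) - V (S (S n)).
Proof.
assert (Hs := reduced_slope_pos).
assert (Hdec := reduced_evolution_decreasing n).
assert (Hx0 := reduced_channel_unit n). assert (Hx1 := reduced_channel_unit (S n)).
assert (HX := reduced_channel_step n). assert (HX' := reduced_channel_increasing n).
destruct (quadratic_expansion_reduced_edge p Rc Hp HR) as [a1 Ha]. fold g in Ha. fold h0 in Ha.
assert (Hlin : 2 * (1 - h0) - / s <= a1).
{ apply (quadratic_expansion_linear_coef g h0); [exact Ha | now apply reduced_edge_1|].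
  intros x Hx. apply Rmult_le_reg_l with s; [lra|].
  replace (s * (/ s * (1 - x))) with (1 - x) by (field; lra). now apply reduced_check_line. }
assert (Hlin' : 2 * s * (1 - h0) - 1 <= s * a1).
{ replace (2 * s * (1 - h0) - 1) with (s * (2 * (1 - h0) - / s)) by (field; lra).
  apply Rmult_le_compat_l; lra. }
assert (Hsl := quadratic_expansion_slope _ _ _ _ _ Ha (conj (proj1 Hx0) HX') (proj2 Hx1)).
assert (Ha1 : 0 <= a1) by apply Ha.
rewrite (reduced_evolution_S (S n)). rewrite (reduced_evolution_S n) at 2.
apply Rle_trans with (s * a1 * (V n - V (S n))).
- apply Rmult_le_compat_r; [lra|]. apply Rmax_lub; [|exact Hlin'].
  apply Rmult_le_pos; lra.
- assert (a1 * (s * (V n - V (S n))) <= a1 * (X (S n) - X n)) by (apply Rmult_le_compat_l; lra).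
  lra.
Qed.

Lemma ratio_unit : 0 <= th < 1.
Proof.
generalize reduced_slope_pos initial_erasure_bounds. intros.
unfold th. split; [apply Rmax_l | apply Rmax_lub_lt; [lra | nra]].
Qed.

Let F := reduced_primitive (1 - p) L.
Let G := reduced_primitive p Rc.
(** Area between the graphs that remains beyond abscissa [X n] and below level [V n]: the part under
    [g] and above [1 - V n], less the part under [f]. *)
Let K n := G 1 - G (X n) - (1 - X n) * (1 - V n) - (F (V n) - F 0).

Lemma gap_area_total : K 0%nat = (1 - p) / mean_degree Rc - p / mean_degree L.
Proof.
unfold K, X. change (V 0%nat) with 1. unfold f. rewrite reduced_edge_1 by assumption.
replace (1 - 1) with 0 by ring. unfold G, F.
rewrite !reduced_primitive_total by assumption. unfold Rdiv. ring.
Qed.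

Let strip n := f (V n) * (V n - V (S n)) - (F (V n) - F (V (S n))).

Lemma strip_area n : s * (V n - V (S n)) ^ 2 / 2 <= strip n.
Proof.
unfold strip, F, f.
generalize (reduced_primitive_strip (1 - p) L q_unit HL (V (S n)) (V n)
  (conj (proj1 (reduced_evolution_unit (S n))) (reduced_evolution_decreasing n))
  (proj2 (reduced_evolution_unit n))).
replace (1 - (1 - p)) with p by ring. auto.
Qed.

Lemma gap_area_step n :
  strip n + s * (V (S n) - V (S (S n))) ^ 2 / 2 <= K n - K (S n).
Proof.
assert (Hx0 := reduced_channel_unit n).
assert (Hx1 := reduced_channel_unit (S n)).
assert (Hlt := reduced_channel_lt_1 (S n)).
assert (HA := slope_bound_area G g s (X n) (X (S n)) (proj1 reduced_slope_pos)
  (reduced_channel_increasing n)).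
assert (HA' : s * (g (X (S n)) - g (X n)) ^ 2 / 2 <=
  G (X (S n)) - G (X n) - (X (S n) - X n) * g (X n)).
{ apply HA.
  - intros z Hz. apply reduced_primitive_derive; [assumption | assumption | lra].
  - intros z z' Hz Hz'. apply reduced_edge_increasing; [assumption | assumption | lra | lra].
  - intros z z' Hz Hz'. apply reduced_check_slope; lra. }
replace (V (S n) - V (S (S n))) with (g (X (S n)) - g (X n))
  by (rewrite (reduced_evolution_S (S n)), (reduced_evolution_S n); ring).
assert (E : K n - K (S n) = strip n + (G (X (S n)) - G (X n) - (X (S n) - X n) * g (X n))).
{ unfold K, strip.
  replace (g (X n)) with (1 - V (S n)) by (rewrite reduced_evolution_S; ring).
  unfold X. ring. }
lra.
Qed.

(** Crude on purpose: a minorant tending to 0 is all the staircase asks for, and each subtracted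
    term is at most [V n]. *)
Lemma gap_area_lower_bound n : - (2 * V n) <= K n.
Proof.
assert (Hv := reduced_evolution_unit n). assert (Hx := reduced_channel_unit n).
assert (Hb := reduced_edge_id_bounds (V n) Hv).
assert (Hm := mean_degree_ge_1 L HL).
assert (HG : G (X n) <= G 1).
{ unfold G. apply Rminus_le_0. rewrite reduced_primitive_sub by (assumption || lra).
  assert (HmR := mean_degree_ge_1 Rc HR).
  apply Rmult_le_pos.
  - apply Rmult_le_pos; apply Rlt_le, accumulator_gain_pos; assumption || lra.
  - apply Rdiv_le_0_compat; [|lra].
    generalize (degree_series_increasing Rc HR (X n) 1 ltac:(lra) ltac:(lra)). lra. }
assert (HF : F (V n) - F 0 <= V n).
{ unfold F. rewrite reduced_primitive_sub by (assumption || lra).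
  rewrite degree_series_0 by assumption.
  assert (Hg0 := accumulator_gain_bounds _ L q_unit HL 0 ltac:(lra)).
  assert (Hg1 := accumulator_gain_bounds _ L q_unit HL (V n) Hv).
  assert (HD := degree_series_le_id L HL (V n) Hv).
  assert (HD0 := degree_series_unit L HL (V n) Hv).
  assert (Hq : (PSeries L (V n) - 0) / mean_degree L <= V n).
  { apply Rmult_le_reg_r with (mean_degree L); [lra|].
    replace ((PSeries L (V n) - 0) / mean_degree L * mean_degree L) with (PSeries L (V n)) by (field; lra).
    nra. }
  assert (Hq0 : 0 <= (PSeries L (V n) - 0) / mean_degree L) by (apply Rdiv_le_0_compat; lra).
  rewrite <- (Rmult_1_l (V n)) at 3. apply Rmult_le_compat; [|exact Hq0 | |exact Hq]; nra. }
assert ((1 - X n) * (1 - V n) <= V n) by (unfold X in *; nra).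
unfold K. lra.
Qed.

(* The first triangle on the check side would extend beyond the unit square.
   Its loss is made up for by the growth of [f] near 1, through the nodes of
   degree at least 3 and through the accumulator gain. *)
Lemma first_strip_area : s * h0 ^ 2 <= (1 + th ^ 2) * strip 0.
Proof.
assert (Hs := reduced_slope_pos).
assert (Hh := initial_erasure_bounds).
assert (Hlam := degree_two_fraction).
assert (Hth := ratio_unit).
assert (Hm := mean_degree_ge_1 L HL).
set (h := h0) in *.
assert (Hh1 : h <= 1) by nra.
assert (HV1 : V 1%nat = 1 - h) by (generalize initial_step; change (V 0%nat) with 1; fold h; lra).
set (y := (1 - PSeries L (1 - h)) / mean_degree L).
set (gain := accumulator_gain (1 - p) L (1 - h)).
assert (Hstrip : strip 0 = h - gain * y).
{ unfold strip. rewrite HV1. change (V 0%nat) with 1. unfold f, F.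
  rewrite reduced_edge_1, reduced_primitive_sub by (assumption || lra).
  rewrite accumulator_gain_1 by assumption. rewrite degree_series_1 by assumption.
  fold gain y. ring. }
(* By [PSeries L x <= x ^ 2] the gain at [1 - h] is at most [p / den]; [h ^ 2 * num / den] is the
   resulting lower bound on the strip. *)
set (den := p + (1 - p) * h * (2 - h)).
set (num := p * ((2 - lam) / 2 - (1 - lam) * h / 3) + (1 - p) * (2 - h)).
assert (Hden : 0 < den).
{ unfold den. assert (0 <= (1 - p) * h * (2 - h)) by (apply Rmult_le_pos; [apply Rmult_le_pos|]; lra). lra. }
assert (Hgain : gain * den <= p).
{ unfold gain, accumulator_gain.
  assert (HD := degree_series_le_square L HL no_degree_one (1 - h) ltac:(lra)).
  assert (Hd : den <= 1 - (1 - p) * PSeries L (1 - h)).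
  { unfold den. replace (p + (1 - p) * h * (2 - h)) with (1 - (1 - p) * (1 - h) ^ 2) by ring.
    apply Rplus_le_compat_l, Ropp_le_contravar, Rmult_le_compat_l; lra. }
  replace (1 - (1 - p)) with p by ring.
  apply Rmult_le_reg_r with (1 - (1 - p) * PSeries L (1 - h)); [lra|].
  replace (p / (1 - (1 - p) * PSeries L (1 - h)) * den * (1 - (1 - p) * PSeries L (1 - h)))
    with (p * den) by (field; lra).
  apply Rmult_le_compat_l; lra. }
assert (Hy : y <= h - h ^ 2 + h ^ 3 / 3 + lam * (h ^ 2 / 2 - h ^ 3 / 3)).
{ apply degree_series_near_1; [assumption | exact no_degree_one | lra]. }
assert (Hy0 : 0 <= y).
{ apply Rdiv_le_0_compat; [|lra].
  generalize (degree_series_unit L HL (1 - h) ltac:(lra)). lra. }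
assert (Hmain : h ^ 2 * num <= strip 0 * den).
{ rewrite Hstrip.
  assert (gain * den * y <= p * (h - h ^ 2 + h ^ 3 / 3 + lam * (h ^ 2 / 2 - h ^ 3 / 3))).
  { apply Rle_trans with (p * y); [apply Rmult_le_compat_r | apply Rmult_le_compat_l]; lra. }
  assert (h ^ 2 * num = h * den - p * (h - h ^ 2 + h ^ 3 / 3 + lam * (h ^ 2 / 2 - h ^ 3 / 3)))
    by (unfold num, den; field).
  lra. }
assert (Hh2 : 0 <= h ^ 2) by apply pow2_ge_0.
destruct (Rle_lt_dec (p ^ 2) (1 / 2)) as [Hp2 | Hp2].
- assert (Hnum := strip_bound_small_p p lam h Hp Hp2 ltac:(lra) Hh). fold s den num in Hnum.
  assert (Hst : s * h ^ 2 <= strip 0).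
  { apply Rmult_le_reg_r with den; [exact Hden|].
    apply Rle_trans with (h ^ 2 * num); [|exact Hmain].
    replace (s * h ^ 2 * den) with (h ^ 2 * (s * den)) by ring.
    now apply Rmult_le_compat_l. }
  assert (0 <= s * h ^ 2) by (apply Rmult_le_pos; lra).
  assert (0 <= th ^ 2 * strip 0) by (apply Rmult_le_pos; [apply pow2_ge_0 | lra]). lra.
- assert (Hnum := strip_bound_large_p p lam h Hp Hp2 ltac:(lra) Hh). fold den num in Hnum.
  assert (Hthe := ratio_bound_large_p p lam h Hp Hp2 ltac:(lra) Hh). fold s in Hthe.
  change (Rmax 0 (2 * s * (1 - h) - 1)) with th in Hthe.
  set (c := 1 - lam / 2 + 3 / 2 * (1 - p)) in *.
  assert (Hst : h ^ 2 * c <= strip 0).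
  { apply Rmult_le_reg_r with den; [exact Hden|].
    apply Rle_trans with (h ^ 2 * num); [|exact Hmain].
    rewrite Rmult_assoc. now apply Rmult_le_compat_l. }
  apply Rle_trans with ((1 + th ^ 2) * c * h ^ 2); [now apply Rmult_le_compat_r|].
  rewrite Rmult_assoc. apply Rmult_le_compat_l; [generalize (pow2_ge_0 th); lra | lra].
Qed.

Lemma reduced_evolution_area l : (1 <= l)%nat ->
  p ^ 2 * (2 * L 2%nat / mean_degree L) * (1 - V l) ^ 2
  <= INR l * ((1 - p) / mean_degree Rc - p / mean_degree L).
Proof.
intros Hl. fold lam s. rewrite <- gap_area_total.
change (1 - V l) with (V 0%nat - V l).
apply (staircase_area K V (fun n => - (2 * V n)) s (strip 0) th).
- generalize reduced_slope_pos. lra.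
- exact ratio_unit.
- intros n. generalize (reduced_evolution_decreasing n). lra.
- exact step_ratio.
- exact Hlim.
- replace (Finite 0) with (Finite (- (2 * 0))) by (f_equal; ring).
  apply (is_lim_seq_opp _ (Finite (2 * 0))).
  now apply (is_lim_seq_scal_l V 2 (Finite 0)).
- exact gap_area_lower_bound.
- exact (gap_area_step 0).
- intros n. generalize (gap_area_step (S n)) (strip_area (S n)). lra.
- rewrite initial_step. exact first_strip_area.
- exact Hl.
Qed.

End ReducedEvolution.

(** * Density evolution *)

Section DensityEvolution.

Variables (p : R) (L Rc : nat -> R).
Hypothesis Hp : 0 < p < 1.
Hypothesis HL : degree_distribution L.
Hypothesis HR : degree_distribution Rc.

Let M n := Nat.iter n (de_step L Rc p) all_erased.

(** Restricted to the components that a step reads from the previous state. *)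
Definition messages_unit (m : messages) : Prop :=
  0 <= x3 m <= 1 /\ 0 <= x4 m <= 1 /\ 0 <= x5 m <= 1.

(** [x0] is included because [de_x5_lower_bound] relies on its decrease over time. *)
Definition messages_le (m m' : messages) : Prop :=
  x0 m <= x0 m' /\ x3 m <= x3 m' /\ x4 m <= x4 m' /\ x5 m <= x5 m'.

Lemma de_step_x0 m : messages_unit m -> p <= x0 (de_step L Rc p m) <= 1.
Proof. intros (_ & _ & H5). simpl. split; nra. Qed.

Lemma de_step_x1 m : messages_unit m -> 0 <= x1 (de_step L Rc p m) <= 1.
Proof.
intros Hm. assert (H0 := de_step_x0 m Hm). destruct Hm as (_ & H4 & _).
change (x1 (de_step L Rc p m)) with (x0 (de_step L Rc p m) ^ 2 * edge_series L (x4 m)).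
assert (H := edge_series_unit L HL _ H4).
assert (0 <= x0 (de_step L Rc p m) ^ 2 <= 1) by (apply pow_unit; lra). nra.
Qed.

Lemma de_step_unit m : messages_unit m -> messages_unit (de_step L Rc p m).
Proof.
intros Hm. assert (H0 := de_step_x0 m Hm). assert (H1 := de_step_x1 m Hm).
destruct Hm as (H3 & _ & _).
set (m' := de_step L Rc p m) in *.
assert (H3' : 0 <= x3 m' <= 1).
{ change (x3 m') with (p * (1 - PSeries Rc (1 - x1 m') * (1 - x3 m))).
  assert (H := degree_series_unit Rc HR (1 - x1 m') ltac:(lra)).
  assert (0 <= PSeries Rc (1 - x1 m') * (1 - x3 m) <= 1) by (split; nra). split; nra. }
assert (H4' : 0 <= x4 m' <= 1).
{ change (x4 m') with (1 - (1 - x3 m') ^ 2 * edge_series Rc (1 - x1 m')).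
  assert (H := edge_series_unit Rc HR (1 - x1 m') ltac:(lra)).
  assert (0 <= (1 - x3 m') ^ 2 <= 1) by (apply pow_unit; lra). split; nra. }
split; [exact H3' | split; [exact H4'|]].
change (x5 m') with (x0 m' * PSeries L (x4 m')).
assert (H := degree_series_unit L HL (x4 m') H4'). split; nra.
Qed.

Lemma de_step_increasing m n : messages_unit m -> messages_unit n -> messages_le m n ->
  messages_le (de_step L Rc p m) (de_step L Rc p n).
Proof.
intros Hm Hn (_ & H3 & H4 & H5).
assert (Hm0 := de_step_x0 m Hm). assert (Hn0 := de_step_x0 n Hn).
assert (Hm1 := de_step_x1 m Hm). assert (Hn1 := de_step_x1 n Hn).
assert (Hm' := de_step_unit m Hm). assert (Hn' := de_step_unit n Hn).
set (m' := de_step L Rc p m) in *. set (n' := de_step L Rc p n) in *.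
destruct Hm as (Um3 & Um4 & Um5). destruct Hn as (Un3 & Un4 & Un5).
destruct Hm' as (Vm3 & Vm4 & Vm5). destruct Hn' as (Vn3 & Vn4 & Vn5).
assert (E0 : x0 m' <= x0 n').
{ change (1 - (1 - x5 m) * (1 - p) <= 1 - (1 - x5 n) * (1 - p)). nra. }
assert (E1 : x1 m' <= x1 n').
{ change (x0 m' ^ 2 * edge_series L (x4 m) <= x0 n' ^ 2 * edge_series L (x4 n)).
  apply Rmult_le_compat; [apply pow2_ge_0 | now apply edge_series_unit | apply pow_incr; lra |].
  apply edge_series_increasing; [exact HL | lra | lra]. }
assert (E3 : x3 m' <= x3 n').
{ change (p * (1 - PSeries Rc (1 - x1 m') * (1 - x3 m)) <=
    p * (1 - PSeries Rc (1 - x1 n') * (1 - x3 n))).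
  apply Rmult_le_compat_l; [lra|]. apply Rplus_le_compat_l, Ropp_le_contravar.
  apply Rmult_le_compat; [apply degree_series_unit; [exact HR | lra] | lra | | lra].
  apply degree_series_increasing; [exact HR | lra | lra]. }
assert (E4 : x4 m' <= x4 n').
{ change (1 - (1 - x3 m') ^ 2 * edge_series Rc (1 - x1 m') <=
    1 - (1 - x3 n') ^ 2 * edge_series Rc (1 - x1 n')).
  apply Rplus_le_compat_l, Ropp_le_contravar.
  apply Rmult_le_compat; [apply pow2_ge_0 | apply edge_series_unit; [exact HR | lra] |
    apply pow_incr; lra |].
  apply edge_series_increasing; [exact HR | lra | lra]. }
repeat split; [exact E0 | exact E3 | exact E4 |].
change (x0 m' * PSeries L (x4 m') <= x0 n' * PSeries L (x4 n')).
apply Rmult_le_compat; [lra | now apply degree_series_unit | exact E0 |].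
apply degree_series_increasing; [exact HL | lra | lra].
Qed.

Lemma de_unit n : messages_unit (M n).
Proof.
induction n as [|n IH]; [unfold messages_unit; simpl; lra | exact (de_step_unit _ IH)].
Qed.

Lemma de_decreasing n : messages_le (M (S n)) (M n).
Proof.
induction n as [|n IH].
- destruct (de_unit 1) as (H3 & H4 & H5). unfold messages_le.
  change (x0 (M 0)) with 1. change (x3 (M 0)) with 1.
  change (x4 (M 0)) with 1. change (x5 (M 0)) with 1.
  assert (H0 := de_step_x0 (M 0) (de_unit 0)). change (de_step L Rc p (M 0)) with (M 1) in H0.
  lra.
- exact (de_step_increasing _ _ (de_unit (S n)) (de_unit n) IH).
Qed.

Lemma de_x5_lower_bound n : x0 (M (S n)) * PSeries L (x4 (M n)) <= x5 (M n).
Proof.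
destruct (de_decreasing n) as (H0 & _).
assert (Hx0 := de_step_x0 (M n) (de_unit n)). change (de_step L Rc p (M n)) with (M (S n)) in Hx0.
destruct (de_unit n) as (_ & H4 & _).
assert (H := degree_series_unit L HL _ H4).
(* The initial state is not the output of a step; there [x5] is 1. *)
destruct n as [|n].
- change (x5 (M 0)) with 1. nra.
- change (x5 (M (S n))) with (x0 (M (S n)) * PSeries L (x4 (M (S n)))).
  apply Rmult_le_compat_r; lra.
Qed.

(* The messages decrease, so replacing the previous state of the two
   accumulators by their fixed point only speeds up the decoding. *)
Lemma de_step_reduced n : reduced_step p L Rc (x4 (M n)) <= x4 (M (S n)).
Proof.
destruct (de_unit n) as (U3 & U4 & U5). destruct (de_unit (S n)) as (V3 & V4 & V5).
assert (H0 := de_step_x0 (M n) (de_unit n)). assert (H1 := de_step_x1 (M n) (de_unit n)).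
change (de_step L Rc p (M n)) with (M (S n)) in H0, H1.
assert (G0 : accumulator_gain (1 - p) L (x4 (M n)) <= x0 (M (S n))).
{ apply accumulator_gain_le; [lra | exact HL | exact U4 |].
  assert (H5 := de_x5_lower_bound n).
  change (x0 (M (S n))) with (1 - (1 - x5 (M n)) * (1 - p)) at 2.
  replace ((1 - p) * PSeries L (x4 (M n)) * x0 (M (S n)))
    with ((1 - p) * (x0 (M (S n)) * PSeries L (x4 (M n)))) by ring. nra. }
assert (G0' := accumulator_gain_pos (1 - p) L ltac:(lra) HL _ U4).
assert (G1 : reduced_edge (1 - p) L (x4 (M n)) <= x1 (M (S n))).
{ change (x1 (M (S n))) with (x0 (M (S n)) ^ 2 * edge_series L (x4 (M n))).
  unfold reduced_edge. apply Rmult_le_compat_r; [now apply edge_series_unit | nra]. }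
assert (G3 : 1 - x3 (M (S n)) <= accumulator_gain p Rc (1 - x1 (M (S n)))).
{ apply accumulator_gain_ge; [exact Hp | exact HR | lra |].
  assert (HD := degree_series_unit Rc HR (1 - x1 (M (S n))) ltac:(lra)).
  destruct (de_decreasing n) as (_ & D3 & _).
  change (x3 (M (S n))) with (p * (1 - PSeries Rc (1 - x1 (M (S n))) * (1 - x3 (M n)))) at 1.
  assert (PSeries Rc (1 - x1 (M (S n))) * (1 - x3 (M n)) <=
    PSeries Rc (1 - x1 (M (S n))) * (1 - x3 (M (S n)))) by (apply Rmult_le_compat_l; lra).
  nra. }
assert (G4 : 1 - x4 (M (S n)) <= reduced_edge p Rc (1 - x1 (M (S n)))).
{ change (x4 (M (S n))) with
    (1 - (1 - x3 (M (S n))) ^ 2 * edge_series Rc (1 - x1 (M (S n)))).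
  unfold reduced_edge. set (c := accumulator_gain p Rc (1 - x1 (M (S n)))) in *.
  assert ((1 - x3 (M (S n))) ^ 2 * edge_series Rc (1 - x1 (M (S n))) <=
    c * c * edge_series Rc (1 - x1 (M (S n)))); [|lra].
  apply Rmult_le_compat_r; [apply edge_series_unit; [exact HR | lra] | nra]. }
unfold reduced_step.
assert (G5 := reduced_edge_unit (1 - p) L ltac:(lra) HL _ U4).
generalize (reduced_edge_increasing p Rc Hp HR
  (1 - x1 (M (S n))) (1 - reduced_edge (1 - p) L (x4 (M n))) ltac:(lra) ltac:(lra)). lra.
Qed.

Lemma reduced_evolution_le n : reduced_evolution p L Rc n <= x4 (M n).
Proof.
induction n as [|n IH]; [apply Rle_refl|].
eapply Rle_trans; [|apply de_step_reduced].
destruct (de_unit n) as (_ & H4 & _).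
apply (reduced_step_increasing p L Rc Hp HL HR (reduced_evolution p L Rc n) (x4 (M n))); [|lra].
split; [now apply reduced_evolution_unit | exact IH].
Qed.

Lemma degree_series_ge_2 v : 0 <= v <= 1 -> L 2%nat * v ^ 2 <= PSeries L v.
Proof.
intros Hv.
apply (is_series_ge_term (fun n => L n * v ^ n) _ 2
  (nonneg_series_correct L v (degree_nonneg_series L HL) Hv)).
intros n _. apply Rmult_le_pos; [apply (dd_nonneg _ HL) | now apply pow_le].
Qed.

(** [x0] is at least [p], and the series of [L] at least its degree-2 term. The state after
    iteration [l] results from [S l] steps. *)
Lemma x5_ge l : p * L 2%nat * reduced_evolution p L Rc (S l) ^ 2 <= x5 (density_evolution L Rc p l).
Proof.
change (density_evolution L Rc p l) with (M (S l)).
assert (H0 := de_step_x0 (M l) (de_unit l)). change (de_step L Rc p (M l)) with (M (S l)) in H0.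
destruct (de_unit (S l)) as (_ & H4 & _).
assert (Hv := reduced_evolution_unit p L Rc Hp HL HR (S l)).
assert (Hle := reduced_evolution_le (S l)).
set (v := reduced_evolution p L Rc (S l)) in *.
change (x5 (M (S l))) with (x0 (M (S l)) * PSeries L (x4 (M (S l)))).
rewrite Rmult_assoc. apply Rmult_le_compat; [lra | | lra |].
- apply Rmult_le_pos; [apply (dd_nonneg _ HL) | apply pow2_ge_0].
- eapply Rle_trans; [now apply degree_series_ge_2|].
  apply degree_series_increasing; [exact HL | lra | lra].
Qed.

Lemma reduced_evolution_lim :
  is_lim_seq (fun l => x4 (density_evolution L Rc p l)) 0 ->
  is_lim_seq (reduced_evolution p L Rc) 0.
Proof.
intros Hlim. apply is_lim_seq_incr_1.
apply (is_lim_seq_le_le (fun _ => 0) _ (fun l => x4 (density_evolution L Rc p l)));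
  [|apply is_lim_seq_const | exact Hlim].
intros n. split; [now apply reduced_evolution_unit | exact (reduced_evolution_le (S n))].
Qed.

End DensityEvolution.

(** * From the area to the number of iterations *)

(** With denominators cleared, the rate bound reads [(1 - eps) * ((1 - p) * aL - p * aR) <= eps *
    aR]. *)
Lemma gap_area_le (p eps aL aR : R) :
  0 < p < 1 -> 0 < eps < 1 -> 0 < aL -> 0 < aR ->
  aR / (aL + aR) >= (1 - eps) * (1 - p) ->
  (1 - eps) * aL * ((1 - p) / aR - p / aL) <= eps.
Proof.
intros Hp He HL HR H.
assert (H1 : (1 - eps) * (1 - p) * (aL + aR) <= aR).
{ apply Rge_le in H. apply (Rmult_le_compat_r (aL + aR)) in H; [|lra].
  replace (aR / (aL + aR) * (aL + aR)) with aR in H by (field; lra). exact H. }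
apply Rmult_le_reg_r with aR; [exact HR|].
replace ((1 - eps) * aL * ((1 - p) / aR - p / aL) * aR)
  with ((1 - eps) * ((1 - p) * aL - p * aR)) by (field; lra).
lra.
Qed.

Theorem theorem2 (p eps Pb : R) (n : nat -> nat) (L Rc : nat -> R)
  (hp : 0 < p < 1) (heps : 0 < eps < 1)
  (hseq : ara_sequence n L Rc)
  (hach : achieves_fraction L Rc p eps)
  (hPb : 0 <= Pb <= p)
  (hL2 : 1 - sqrt (1 - Pb / p) < p * L 2%nat) :
  Rbar_le
    (Finite (2 * p * (1 - eps)
             * (sqrt (p * L 2%nat) - sqrt (1 - sqrt (1 - Pb / p))) ^ 2
             * (1 / eps)))
    (num_iterations L Rc p Pb).
Proof.
assert (HL := ara_punctured _ _ _ hseq). assert (HR := ara_check2 _ _ _ hseq).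
unfold num_iterations. destruct LPO_min as [[l [[Hl Hstop] _]] | Hnone]; [|exact I].
unfold Rbar_le. destruct l as [|l]; [lia|].
replace (S l - 1)%nat with l in Hstop by lia.
(* The value of [x5] at which the systematic erasure probability equals [Pb]. *)
set (delta := 1 - sqrt (1 - Pb / p)) in *.
assert (HPb : 0 <= Pb / p <= 1).
{ split; [apply Rdiv_le_0_compat; lra|]. apply Rmult_le_reg_r with p; [lra|].
  unfold Rdiv. rewrite Rmult_assoc, Rinv_l; lra. }
assert (Hdelta : 0 <= delta).
{ unfold delta. rewrite <- sqrt_1 at 1. apply Rle_minus_r. rewrite Rplus_0_l.
  apply sqrt_le_1; lra. }
assert (HL2 : 0 < L 2%nat) by (apply Rmult_lt_reg_l with p; lra).
assert (Hx5 : x5 (density_evolution L Rc p l) <= delta).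
{ unfold systematic_erasure in Hstop.
  destruct (de_unit p L Rc hp HL HR (S l)) as (_ & _ & H5).
  change (Nat.iter (S l) (de_step L Rc p) all_erased) with (density_evolution L Rc p l) in H5.
  set (x := x5 (density_evolution L Rc p l)) in *.
  assert (sqrt (1 - Pb / p) <= 1 - x); [|unfold delta; lra].
  rewrite <- (sqrt_pow2 (1 - x)) by lra. apply sqrt_le_1_alt.
  apply Rmult_le_reg_l with p; [lra|].
  replace (p * (1 - Pb / p)) with (p - Pb) by (field; lra). lra. }
assert (Hlim := reduced_evolution_lim p L Rc hp HL HR (af_x4 _ _ _ _ hach)).
assert (Harea := reduced_evolution_area p L Rc hp HL HR HL2 Hlim (S l) Hl).
assert (Hv5 := x5_ge p L Rc hp HL HR l).
assert (Hv := reduced_evolution_unit p L Rc hp HL HR (S l)).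
set (v := reduced_evolution p L Rc (S l)) in *.
assert (Ha := mean_degree_ge_1 L HL). assert (Hb := mean_degree_ge_1 Rc HR).
assert (Hgap := gap_area_le p eps (mean_degree L) (mean_degree Rc) hp heps ltac:(lra) ltac:(lra) (af_rate _ _ _ _ hach)).
set (D := (1 - p) / mean_degree Rc - p / mean_degree L) in *.
set (N := INR (S l)) in *.
assert (HN : 0 <= N) by apply pos_INR.
(* From [p * L 2 * v ^ 2 <= x5 <= delta] by taking roots; [hL2] makes the difference of roots
   non-negative, so that squaring preserves the order. *)
assert (Hroot : (sqrt (p * L 2%nat) - sqrt delta) ^ 2 <= p * L 2%nat * (1 - v) ^ 2).
{ assert (Hsq : sqrt (p * L 2%nat) * v <= sqrt delta).
  { rewrite <- (sqrt_pow2 v) by lra. rewrite <- sqrt_mult by nra. apply sqrt_le_1_alt. lra. }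
  assert (Hlt : sqrt delta <= sqrt (p * L 2%nat)) by (apply sqrt_le_1_alt; lra).
  rewrite <- (pow2_sqrt (p * L 2%nat)) at 2 by nra.
  rewrite <- Rpow_mult_distr. apply pow_incr. lra. }
set (B := (sqrt (p * L 2%nat) - sqrt delta) ^ 2) in *.
(* Multiplying by the mean degree of [L] turns the edge fraction [2 * L 2 / mean_degree L] into the
   node fraction. *)
assert (H1 : 2 * p * (p * L 2%nat * (1 - v) ^ 2) <= N * (mean_degree L * D)).
{ apply (Rmult_le_compat_l (mean_degree L)) in Harea; [|lra].
  replace (2 * p * (p * L 2%nat * (1 - v) ^ 2)) with
    (mean_degree L * (p ^ 2 * (2 * L 2%nat / mean_degree L) * (1 - v) ^ 2)) by (field; lra).
  lra. }
assert (H2 : 2 * p * B <= 2 * p * (p * L 2%nat * (1 - v) ^ 2)) by (apply Rmult_le_compat_l; lra).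
assert (H3 : (1 - eps) * (2 * p * B) <= (1 - eps) * (N * (mean_degree L * D)))
  by (apply Rmult_le_compat_l; lra).
assert (H4 : N * ((1 - eps) * mean_degree L * D) <= N * eps) by (apply Rmult_le_compat_l; lra).
apply Rmult_le_reg_r with eps; [lra|].
replace (2 * p * (1 - eps) * B * (1 / eps) * eps) with ((1 - eps) * (2 * p * B)) by (field; lra).
lra.
Qed.
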